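(* Let $\nu,a,b\in\mathbb{R}$ with $0<b+\nu<(a+\nu)/4$ (so $b<a$). Then: (1) the equation $\lambda_2(a,u,b)=\lambda_3(a,u,b)$ has a unique solution $u=u^*$ in the interval $b<u<a$; put $\alpha=\lambda_2(a,u^*,b)$. (2) There are functions $u_2,u_3$ of $(x,t)$, defined for $t>0$ and $(3a-\nu)/4<x/t<2a+b+2\nu$, with $b\le u_3<u_2<a$, such that, with $u_1\equiv a$: - for $(3a-\nu)/4<x/t\le\alpha$: $x=\lambda_2(a,u_2,u_3)\,t$ and $x=\lambda_3(a,u_2,u_3)\,t$; - for $\alpha\le x/t<2a+b+2\nu$: $x=\lambda_2(a,u_2,b)\,t$ and $u_3=b$; and $(u_1,u_2,u_3)$ solves the Whitham equations $\partial_t u_i+\lambda_i(u_1,u_2,u_3)\,\partial_x u_i=0$, $i=1,2,3$, in this region. (3) Outside this region the solution of the Burgers equation $u_t+(3u+2\nu)u_x=0$ with step initial data $u(x,0)=a$ for $x<0$, $u(x,0)=b$ for $x>0$ is $u\equiv a$ for $x/t\le(3a-\nu)/4$ and $u\equiv b$ for $x/t\ge 2a+b+2\nu$; the boundaries $x/t=(3a-\nu)/4$ (trailing edge, where $u_1=u$ and $u_2=u_3$) and $x/t=2a+b+2\nu$ (leading edge, where $u_1=u_2$ and $u_3=u$) separate the Whitham region from the Burgers region.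
   Context: For $-\nu<u_3<u_2<u_1$ define $$I(u_1,u_2,u_3)=\int_{u_3}^{u_2}\frac{\eta+\nu}{\sqrt{(\eta+\nu)(u_1-\eta)(u_2-\eta)(\eta-u_3)}}\,d\eta,$$ and for $i=1,2,3$ $$\lambda_i=u_1+u_2+u_3+2\nu-\frac{I}{\partial I/\partial u_i}.$$ These functions extend continuously to the boundary of their domain. - On $u_2=u_3<u_1$: $\lambda_1=3u_1+2\nu$ and $\lambda_2=\lambda_3=u_1+2u_3+2\nu-4(u_3+\nu)(u_1-u_3)/(u_1+\nu)$. - On $u_1=u_2>u_3$: $\lambda_1=\lambda_2=2u_1+u_3+2\nu$ and $\lambda_3=3u_3+2\nu$. The Whitham equations are the system $\partial_t u_i+\lambda_i\partial_x u_i=0$ for $-\nu<u_3<u_2<u_1$. They arise as modulation equations of the Camassa–Holm equation with step initial data.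
   Formalization: The Whitham equations are asserted, in the classical sense, in the region with the line x/t = α removed; on that line u_3 has a kink (left slope in x/t nonzero, right slope zero), so ∂_x u_3 and ∂_t u_3 do not exist there and the system cannot hold classically. *)

(* Defs.v *)
From HB Require Import structures.
From mathcomp Require Import all_boot all_order all_algebra.
From mathcomp Require Import all_classical all_reals all_analysis.
Set Implicit Arguments. Unset Strict Implicit. Unset Printing Implicit Defensive.
Import Order.TTheory GRing.Theory Num.Theory.
Import numFieldNormedType.Exports.
Local Open Scope classical_set_scope.
Local Open Scope ring_scope.

Section Whitham.
Variable R : realType.

(* I(u1,u2,u3) = \int_{u3}^{u2} (eta+nu)/sqrt((eta+nu)(u1-eta)(u2-eta)(eta-u3)) d eta
   (improper at both endpoints; taken as a Lebesgue integral over ]u3,u2[). *)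
Definition Iint (nu u1 u2 u3 : R) : R :=
  \int[@lebesgue_measure R]_(eta in `]u3, u2[)
     ((eta + nu) / Num.sqrt ((eta + nu) * (u1 - eta) * (u2 - eta) * (eta - u3))).

Definition dI1 (nu u1 u2 u3 : R) : R := derive1 (fun s => Iint nu s u2 u3) u1.
Definition dI2 (nu u1 u2 u3 : R) : R := derive1 (fun s => Iint nu u1 s u3) u2.
Definition dI3 (nu u1 u2 u3 : R) : R := derive1 (fun s => Iint nu u1 u2 s) u3.

(* Whitham speeds lambda_i = u1+u2+u3+2nu - I / (dI/du_i), on -nu<u3<u2<u1 *)
Definition lam1 (nu u1 u2 u3 : R) : R :=
  u1 + u2 + u3 + 2 * nu - Iint nu u1 u2 u3 / dI1 nu u1 u2 u3.
Definition lam2 (nu u1 u2 u3 : R) : R :=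
  u1 + u2 + u3 + 2 * nu - Iint nu u1 u2 u3 / dI2 nu u1 u2 u3.
Definition lam3 (nu u1 u2 u3 : R) : R :=
  u1 + u2 + u3 + 2 * nu - Iint nu u1 u2 u3 / dI3 nu u1 u2 u3.

Definition transport_at (u c : R -> R -> R) (x t : R) : Prop :=
  derivable (fun s => u s t) x 1 /\ derivable (fun s => u x s) t 1 /\
  derive1 (fun s => u x s) t + c x t * derive1 (fun s => u s t) x = 0.

(* step-data Burgers solution outside the Whitham zone:
   a for x/t <= (3a-nu)/4, b for x/t >= 2a+b+2nu (initial data a for x<0, b for x>0) *)
Definition burgers_outer (nu a b x t : R) : R :=
  if t == 0 then (if x < 0 then a else b)
  else if x / t <= (3 * a - nu) / 4 then a else b.

End Whitham.

(* Main.v *)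
(** Shift by [nu] and put A = a + nu. The substitution eta = q + (p - q) sin^2 x turns
    I(a, u2, u3) into twice J(p, q) = int_0^(pi/2) phi(eta) dx with
    phi(y) = sqrt (y / (A - y)), p = u2 + nu and q = u3 + nu, so that the partial
    derivatives of I become integrals of derivatives of phi. The Euler-Poisson-Darboux
    identity Jp - Jq = 2 (p - q) K, K = Jpq, shows that lambda_2 = lambda_3 exactly where
    K = 0. As phi'' is increasing and has the sign of y - A/4, K increases in p, is
    negative for p <= A/4 and positive for p near A; for q < A/4 its zero p = P(q) is
    therefore unique, and it is differentiable in q by implicit differentiation.
    Along the curve p = P(q) the speed lambda_2 is stationary in q, hence
    L(q) = lambda_2(P(q), q) is strictly decreasing, with limit 3A/4 at q = A/4; beyond
    the curve lambda_2 is strictly increasing in p, with limit 2A + q at p = A.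
    Inverting L, and then lambda_2(., b), gives functions of x/t; any function of x/t
    is transported with speed x/t. *)
Require Import Defs.
From HB Require Import structures.
From mathcomp Require Import all_boot all_order all_algebra.
From mathcomp Require Import all_classical all_reals all_analysis.
From mathcomp Require Import measurable_realfun ring lra.
Import Order.TTheory GRing.Theory Num.Theory.
Import numFieldNormedType.Exports.
Local Open Scope classical_set_scope.
Local Open Scope ring_scope.

(** After the substitution the domain is fixed, and each partial derivative merely multiplies the
    weight by sin^2 x or cos^2 x. Two-variable differentiability is needed, not just partial
    derivatives, because speeds are differentiated along the curve p = P(q). The delicate end is p =
    A, where phi is unbounded. There J is negligible against Jp, and this single fact gives both the
    positive sign of K and the limit 2A + q of the speed. The number A/4 is the inflection point of
    phi. The curve K = 0 runs into the diagonal there, and 3A/4 is the diagonal speed A + 2y - 4y(A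
    - y)/A at y = A/4. Both monotonicity claims rest on Jpp > 0 where K >= 0. Since phi'' changes
    sign along the segment, this is not a pointwise fact but a comparison of the weights of Jpp and
    K. The speed lambda_1 is never computed: u1 is constant. *)

Section DeriveLambda.
Context {R : realType}.
Implicit Types (f g : R -> R) (x a b : R).

(* Not a class, so that derivatives can be built goal-directed on [fun]-terms. *)
Definition drv f x a : Prop := is_derive x 1 f a.

Lemma drv_id x : drv (fun y => y) x 1.
Proof. exact: is_derive_id. Qed.

Lemma drv_cst c x : drv (fun=> c) x 0.
Proof. exact: is_derive_cst. Qed.

Lemma drvD f g x a b : drv f x a -> drv g x b -> drv (fun y => f y + g y) x (a + b).
Proof. exact: is_deriveD. Qed.

Lemma drvN f x a : drv f x a -> drv (fun y => - f y) x (- a).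
Proof. exact: is_deriveN. Qed.

Lemma drvM f g x a b : drv f x a -> drv g x b ->
  drv (fun y => f y * g y) x (a * g x + f x * b).
Proof.
move=> df dg; apply: (@is_derive_eq _ _ _ (f * g) x 1 _ _ (is_deriveM df dg)).
by rewrite addrC (mulrC a).
Qed.

Lemma drvV f x a : f x != 0 -> drv f x a -> drv (fun y => (f y)^-1) x (- a / f x ^+ 2).
Proof.
move=> fx df; apply: (is_derive_eq (is_deriveV fx df)).
by rewrite /GRing.scale/= !mulNr mulrC.
Qed.

Lemma drv_comp f g x a b : drv f (g x) a -> drv g x b -> drv (fun y => f (g y)) x (a * b).
Proof. exact: is_derive1_comp. Qed.

Lemma drv_eq f x a b : drv f x a -> a = b -> drv f x b.
Proof. by move=> ? <-. Qed.

Lemma drv_continuous f x a : drv f x a -> {for x, continuous f}.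
Proof. by case=> h _; apply/differentiable_continuous/derivable1_diffP. Qed.

End DeriveLambda.

(** The derivative is left as an existential variable, built from the shape of the function;
    [drv_eq] then compares it with the wanted formula. The argument [tac] handles the atoms and is
    tried before the product rule. *)
Ltac drv_lambda tac := repeat first
  [ eapply drv_cst | eapply drv_id | tac | eapply drvM | eapply drvD | eapply drvN ].

(** * Integrals of continuous functions over a segment *)

Section SegmentIntegral.
Context {R : realType}.
Implicit Types (f g F : R -> R) (a b : R).
Notation mu := (@lebesgue_measure R).

Lemma continuous_integrable_itvcc f a b : continuous f ->
  mu.-integrable `[a, b] (EFin \o f).
Proof.
move=> cf; apply: continuous_compact_integrable; first exact: segment_compact.
exact: continuous_subspaceT.
Qed.

Definition sint a b f : R := \int[mu]_(x in `[a, b]) f x.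

Lemma sintD a b f g : continuous f -> continuous g ->
  sint a b (fun x => f x + g x) = sint a b f + sint a b g.
Proof.
move=> cf cg; by apply: RintegralD => //; exact: continuous_integrable_itvcc.
Qed.

Lemma sintB a b f g : continuous f -> continuous g ->
  sint a b (fun x => f x - g x) = sint a b f - sint a b g.
Proof.
move=> cf cg; apply: RintegralB => //; exact: continuous_integrable_itvcc.
Qed.

Lemma sintZ a b r f : continuous f ->
  sint a b (fun x => r * f x) = r * sint a b f.
Proof.
move=> cf; apply: RintegralZl => //; exact: continuous_integrable_itvcc.
Qed.

Lemma eq_sint a b f g : (forall x, a <= x <= b -> f x = g x) ->
  sint a b f = sint a b g.
Proof.
by move=> fg; apply: eq_Rintegral => x; rewrite inE/= in_itv/= => /fg.
Qed.

Lemma le_sint a b f g : continuous f -> continuous g ->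
  (forall x, a <= x <= b -> f x <= g x) -> sint a b f <= sint a b g.
Proof.
by move=> cf cg fg; apply: le_Rintegral => //; exact: continuous_integrable_itvcc.
Qed.

Lemma sint_ge0 a b f : (forall x, a <= x <= b -> 0 <= f x) -> 0 <= sint a b f.
Proof. by move=> f0; apply: Rintegral_ge0 => x /=; rewrite in_itv/=; exact: f0. Qed.

Lemma sint_cst a b r : a <= b -> sint a b (fun=> r) = r * (b - a).
Proof.
move=> ab; rewrite /sint Rintegral_cst//= lebesgue_measure_itv/= lte_fin.
case: ltgtP ab => [//|//|->]; by rewrite subrr /= mulr0.
Qed.

Lemma normr_sint_le a b f g : continuous f -> continuous g ->
  (forall x, a <= x <= b -> `|f x| <= g x) -> `|sint a b f| <= sint a b g.
Proof.
move=> cf cg fg; rewrite ler_norml; apply/andP; split; last first.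
  by apply: le_sint => // x /fg; apply: le_trans; exact: ler_norm.
rewrite -mulN1r -sintZ//; apply: le_sint => //.
  by move=> x; apply: cvgM; [exact: cvg_cst|exact: cg].
by move=> x /fg; rewrite ler_norml mulN1r => /andP[].
Qed.

Lemma sint_FTC2 a b f F : a < b -> continuous f ->
  (forall x, drv F x (f x)) -> sint a b f = F b - F a.
Proof.
move=> ab cf dF; rewrite /sint /Rintegral.
have cF : continuous F.
  by move=> x; apply/differentiable_continuous/derivable1_diffP; case: (dF x).
rewrite (@continuous_FTC2 _ f F a b)//.
- exact: continuous_subspaceT.
- split.
  + by move=> x _; case: (dF x).
  + by apply: cvg_at_right_filter; exact: cF.
  + by apply: cvg_at_left_filter; exact: cF.
- by move=> x _; rewrite derive1E; case: (dF x).
Qed.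

Lemma sint_subset a b u v f : continuous f -> a <= u -> v <= b ->
  (forall x, a <= x <= b -> 0 <= f x) -> sint u v f <= sint a b f.
Proof.
move=> cf au vb f0; apply: fine_le.
- by apply: integrable_fin_num => //; exact: continuous_integrable_itvcc.
- by apply: integrable_fin_num => //; exact: continuous_integrable_itvcc.
- apply: ge0_subset_integral => //=.
  + by case/integrableP: (continuous_integrable_itvcc f a b cf).
  + by apply: subset_itv; rewrite bnd_simp.
Qed.

(** Continuity keeps [f] above [f x0 / 2] on a subsegment of positive length. The point [x0] may be
    an endpoint, hence the clipping of [u] and [v] to the segment. *)
Lemma sint_gt0 a b f x0 : a < b -> continuous f ->
  (forall x, a <= x <= b -> 0 <= f x) -> a <= x0 <= b -> 0 < f x0 ->
  0 < sint a b f.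
Proof.
move=> ab cf f0 /andP[ax xb] fx0.
have [d /= d0 dP] : \forall x \near x0, f x0 / 2 < f x.
  have f2 : 0 < f x0 / 2 by lra.
  move/cvgrPdist_lt : (cf x0) => /(_ _ f2); apply: filterS => x.
  rewrite ltr_norml; lra.
pose u := Num.max a (x0 - d / 2); pose v := Num.min b (x0 + d / 2).
have uv : u < v by rewrite /u /v gt_max !lt_min; lra.
have ux x : u <= x <= v -> f x0 / 2 <= f x.
  rewrite /u /v ge_max le_min => /andP[/andP[_ h1] /andP[_ h2]].
  by apply/ltW/dP; rewrite /ball /= ltr_norml; lra.
apply: (@lt_le_trans _ _ (sint u v f)); last first.
  by apply: sint_subset => //; rewrite /u /v ?le_max ?ge_min lexx.
apply: (@lt_le_trans _ _ (sint u v (fun=> f x0 / 2))).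
  rewrite sint_cst ?(ltW uv)// mulr_gt0//; lra.
by apply: le_sint => // x; exact: cvg_cst.
Qed.

Lemma lt_sint a b f g x0 : a < b -> continuous f -> continuous g ->
  (forall x, a <= x <= b -> f x <= g x) -> a <= x0 <= b -> f x0 < g x0 ->
  sint a b f < sint a b g.
Proof.
move=> ab cf cg fg x0ab fgx; rewrite -subr_gt0 -sintB//.
apply: (@sint_gt0 _ _ _ x0) => //; last by rewrite subr_gt0.
  by move=> x; apply: continuousB; [exact: cg|exact: cf].
by move=> x /fg; rewrite subr_ge0.
Qed.

End SegmentIntegral.

(** * Differentiability in two variables, chain rule, implicit differentiation *)

Section Gradient.
Context {R : realType}.

Lemma is_derive1_epsP (f : R -> R) (x l : R) :
  is_derive x 1 f l <->
  forall e : R, 0 < e -> exists2 d : R, 0 < d &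
    forall y, `|y - x| < d -> `|f y - f x - l * (y - x)| <= e * `|y - x|.
Proof.
split.
  move=> /is_derive1_caratheodory[g [fE gC gx]] e e0.
  have /cvgrPdist_le /(_ e e0) [d /= d0 dP] := gC.
  exists d => // y yx; rewrite fE -mulrBl normrM ler_wpM2r//.
  by rewrite -gx distrC; apply: dP; rewrite /ball/= distrC.
move=> h; apply/is_derive1_caratheodory.
exists (fun y => if y == x then l else (f y - f x) / (y - x)); split.
- move=> y; case: eqVneq => [->|yx]; first by rewrite !subrr mulr0.
  by rewrite divfK// subr_eq0.
- apply/cvgrPdist_le => e e0; have [d d0 dP] := h e e0.
  near=> y.
  have /dP : `|y - x| < d by rewrite distrC; near: y; exists d.
  rewrite eqxx.
  case: eqVneq => [_ _|yx]; first by rewrite subrr normr0 (ltW e0).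
  have yx0 : 0 < `|y - x| by rewrite normr_gt0 subr_eq0.
  by move=> hy; rewrite -(ler_pM2r yx0) distrC -normrM mulrBl divfK ?subr_eq0.
- by rewrite eqxx.
Unshelve. all: by end_near. Qed.

(** Total differentiability at (p, q) with partial derivatives [a] and [b], the remainder being
    measured in the sum norm. *)
Definition grad (F : R -> R -> R) (p q a b : R) :=
  forall e : R, 0 < e -> exists2 d : R, 0 < d & forall p' q',
    `|p' - p| < d -> `|q' - q| < d ->
    `|F p' q' - F p q - (a * (p' - p) + b * (q' - q))| <=
      e * (`|p' - p| + `|q' - q|).

(** Differentiability implies continuity. Arbitrary filters are allowed so that one-sided limits are
    covered too. *)
Lemma grad_cvg (F : R -> R -> R) p q a b (T : Type) (Fl : set_system T)
    {FF : Filter Fl} (u v : T -> R) : grad F p q a b ->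
  u x @[x --> Fl] --> p -> v x @[x --> Fl] --> q ->
  F (u x) (v x) @[x --> Fl] --> F p q.
Proof.
move=> gF up vq; apply/cvgrPdist_le => e e0.
have [d d0 dP] := gF 1 ltr01.
pose M := `|a| + `|b| + 2.
have M0 : 0 < M by rewrite /M; have := normr_ge0 a; have := normr_ge0 b; lra.
pose r := Num.min d (e / (2 * M)).
have r0 : 0 < r by rewrite lt_min d0/= divr_gt0// mulr_gt0.
have [rd re] : r <= d /\ r <= e / (2 * M) by split; rewrite ge_min lexx ?orbT.
move/cvgrPdist_lt : up => /(_ r r0) up; move/cvgrPdist_lt : vq => /(_ r r0) vq.
near=> x.
have h1 : `|u x - p| < r by rewrite distrC; near: x.
have h2 : `|v x - q| < r by rewrite distrC; near: x.
have := dP _ _ (lt_le_trans h1 rd) (lt_le_trans h2 rd).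
rewrite (distrC (F p q)).
set D := F (u x) (v x) - F p q; rewrite mul1r => hD.
have hD2 : `|D| <= (`|a| + 1) * `|u x - p| + (`|b| + 1) * `|v x - q|.
  have := ler_normD (D - (a * (u x - p) + b * (v x - q))) (a * (u x - p) + b * (v x - q)).
  rewrite subrK; have := ler_normD (a * (u x - p)) (b * (v x - q)).
  rewrite !normrM; lra.
apply: (le_trans hD2).
have : (`|a| + 1) * `|u x - p| <= (`|a| + 1) * r.
  by rewrite ler_pM2l ?ltW//; have := normr_ge0 a; lra.
have : (`|b| + 1) * `|v x - q| <= (`|b| + 1) * r.
  by rewrite ler_pM2l ?ltW//; have := normr_ge0 b; lra.
have : M * r <= e.
  move: re; rewrite ler_pdivlMr ?mulr_gt0//.
  have : 0 <= M * r by rewrite ltW// mulr_gt0.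
  rewrite (mulrCA r 2 M) (mulrC r M); lra.
rewrite /M; lra.
Unshelve. all: by end_near. Qed.

Lemma is_derive1_lip (u : R -> R) (x l : R) : is_derive x 1 u l ->
  exists2 d : R, 0 < d & forall y, `|y - x| < d -> `|u y - u x| <= (`|l| + 1) * `|y - x|.
Proof.
move=> /is_derive1_epsP /(_ 1 ltr01) [d d0 dP]; exists d => // y /dP.
have := ler_normD (u y - u x - l * (y - x)) (l * (y - x)).
rewrite subrK normrM; lra.
Qed.

Lemma grad_derive (F : R -> R -> R) a b (u v : R -> R) (x du dv : R) :
  grad F (u x) (v x) a b -> is_derive x 1 u du -> is_derive x 1 v dv ->
  is_derive x 1 (fun s => F (u s) (v s)) (a * du + b * dv).
Proof.
move=> gF hu hv; apply/is_derive1_epsP => e e0.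
have [du1 du10 luP] := is_derive1_lip _ _ _ hu.
have [dv1 dv10 lvP] := is_derive1_lip _ _ _ hv.
(* The error [e] is split in two: one half for the remainder of [F], whose increments are at most
   [M] times [|y - x|] in sum, the other for the remainders of [u] and [v], which [F] amplifies by
   at most [N]. *)
pose M := `|du| + `|dv| + 2; pose N := `|a| + `|b| + 1.
have M0 : 0 < M by rewrite /M; have := normr_ge0 du; have := normr_ge0 dv; lra.
have N0 : 0 < N by rewrite /N; have := normr_ge0 a; have := normr_ge0 b; lra.
have eM : 0 < e / (2 * M) by rewrite divr_gt0// mulr_gt0.
have eN : 0 < e / (2 * N) by rewrite divr_gt0// mulr_gt0.
have [d1 d10 gP] := gF _ eM.
move/is_derive1_epsP : hu => /(_ _ eN) [d2 d20 uP].
move/is_derive1_epsP : hv => /(_ _ eN) [d3 d30 vP].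
exists (Num.min (Num.min (Num.min du1 dv1) (d1 / M)) (Num.min d2 d3)).
  by rewrite !lt_min du10 dv10 d20 d30 divr_gt0.
move=> y; rewrite !lt_min -!andbA => /and5P[y1 y2 y3 y4 y5].
set w := `|y - x| in y1 y2 y3 y4 y5 *.
have w0 : 0 <= w by exact: normr_ge0.
have {luP} hu1 := luP _ y1; have {lvP} hv1 := lvP _ y2.
have {uP} hu2 := uP _ y4; have {vP} hv2 := vP _ y5.
rewrite -/w in hu1 hv1 hu2 hv2.
have wM : M * w < d1 by rewrite mulrC -ltr_pdivlMr.
have n1 := normr_ge0 du; have n2 := normr_ge0 dv.
have nd1 : 0 <= `|du| * w by rewrite mulr_ge0.
have nd2 : 0 <= `|dv| * w by rewrite mulr_ge0.
have {gP} : `|F (u y) (v y) - F (u x) (v x) - (a * (u y - u x) + b * (v y - v x))|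
    <= e / (2 * M) * (`|u y - u x| + `|v y - v x|).
  apply: gP; [apply: (le_lt_trans hu1)|apply: (le_lt_trans hv1)];
    apply: le_lt_trans wM; rewrite /M; lra.
set D := F _ _ - _ => hD.
have h1 : e / (2 * M) * (`|u y - u x| + `|v y - v x|) <= e / 2 * w.
  have -> : e / 2 * w = e / (2 * M) * (M * w) by field; rewrite gt_eqF.
  rewrite ler_pM2l// /M; lra.
have h2 : `|a * (u y - u x - du * (y - x))| <= `|a| * (e / (2 * N) * w).
  by rewrite normrM ler_wpM2l.
have h3 : `|b * (v y - v x - dv * (y - x))| <= `|b| * (e / (2 * N) * w).
  by rewrite normrM ler_wpM2l.
have h4 : (`|a| + `|b|) * (e / (2 * N) * w) <= e / 2 * w.
  have -> : e / 2 * w = N * (e / (2 * N) * w) by field; rewrite gt_eqF.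
  have eNw : 0 <= e / (2 * N) * w by apply: mulr_ge0 => //; exact: ltW.
  by rewrite ler_wpM2r// /N; lra.
have -> : D - (a * du + b * dv) * (y - x) =
  (D - (a * (u y - u x) + b * (v y - v x))) + (a * (u y - u x - du * (y - x)) +
     b * (v y - v x - dv * (y - x))) by ring.
apply: (le_trans (ler_normD _ _)).
have := ler_normD (a * (u y - u x - du * (y - x))) (b * (v y - v x - dv * (y - x))).
lra.
Qed.

(** The zero curve is given and continuous, so only its derivative is at stake. The expansion of [F]
    along it reads a du + b dq = o(|du| + |dq|); as a is nonzero, this first bounds |du| by a
    multiple of |dq|, and the error then becomes o(|dq|). *)
Lemma grad_implicit (F : R -> R -> R) (P : R -> R) (q a b : R) :
  grad F (P q) q a b -> a != 0 -> {for q, continuous P} ->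
  (\forall s \near q, F (P s) s = 0) -> is_derive q 1 P (- b / a).
Proof.
move=> gF a0 cP [d0 /= d00 F0]; apply/is_derive1_epsP => e e0.
have na : 0 < `|a| by rewrite normr_gt0.
have nb := normr_ge0 b.
(* An error factor at most |a|/2 gives |a| |u| <= (2|b| + |a|) |w|, hence |u| + |w| <= M |w|. *)
pose M := 2 * (`|b| + `|a|) / `|a| + 1.
have M0 : 0 < M by rewrite /M ltr_wpDl// divr_ge0// mulr_ge0//; lra.
pose e1 := Num.min (`|a| / 2) (e * `|a| / M).
have e10 : 0 < e1 by rewrite lt_min !divr_gt0// mulr_gt0.
have [h1 h2] : e1 <= `|a| / 2 /\ e1 <= e * `|a| / M.
  by split; rewrite ge_min lexx ?orbT.
have [d1 d10 gP] := gF _ e10.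
move/cvgrPdist_lt : cP => /(_ _ d10) [d2 /= d20 P2].
exists (Num.min d0 (Num.min d1 d2)); first by rewrite !lt_min d00 d10.
move=> y; rewrite !lt_min => /and3P[y0 y1 y2].
have Fq : F (P q) q = 0 by apply: F0; rewrite /= subrr normr0.
have Fy : F (P y) y = 0 by apply: F0; rewrite /= distrC.
have Py : `|P y - P q| < d1 by rewrite distrC; apply: P2; rewrite /= distrC.
have := gP _ _ Py y1; rewrite Fq Fy subrr sub0r normrN.
set u := P y - P q; set w := y - q => hu.
have nu0 := normr_ge0 u; have nw0 := normr_ge0 w.
have hu2 : `|u| + `|w| <= M * `|w|.
  have g1 : `|a| * `|u| <= `|a * u + b * w| + `|b| * `|w|.
    rewrite -!normrM; have := ler_normB (a * u + b * w) (b * w).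
    by rewrite addrK.
  have g2 : e1 * (`|u| + `|w|) <= `|a| / 2 * (`|u| + `|w|).
    by rewrite ler_wpM2r//; lra.
  have g3 : `|a| * `|u| <= (2 * `|b| + `|a|) * `|w| by lra.
  rewrite /M mulrDl mul1r lerD2r.
  rewrite mulrAC ler_pdivlMr// mulrC; apply: (le_trans g3).
  rewrite ler_wpM2r//; lra.
have -> : u - - b / a * w = (a * u + b * w) / a by field.
rewrite normrM normfV ler_pdivrMr//; apply: (le_trans hu).
apply: (@le_trans _ _ (e * `|a| / M * (M * `|w|))).
  by apply: ler_pM => //; rewrite ?(ltW e10)// addr_ge0.
rewrite le_eqVlt; apply/orP; left; apply/eqP; field; by rewrite gt_eqF.
Qed.

End Gradient.

(** * Change of variables on an open interval with singular endpoints *)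

Section OpenSubstitution.
Context {R : realType}.
Notation mu := (@lebesgue_measure R).

(* [G] may blow up at the endpoints, where [(G \o F) * f] extends continuously. *)
Lemma ge0_integration_by_substitution_oo (F f G H : R -> R) (a b : R) : a < b ->
  (forall x, drv F x (f x)) -> continuous f ->
  {in `[a, b] &, {homo F : x y / x < y}} ->
  {in `]F a, F b[, continuous G} ->
  (forall y, F a < y < F b -> 0 <= G y) ->
  continuous H -> (forall x, a < x < b -> H x = G (F x) * f x) ->
  (forall x, a < x < b -> 0 <= H x) ->
  \int[mu]_(y in `]F a, F b[) G y = sint a b H.
Proof.
move=> ab dF cf incF cG G0 cH HE H0.
have cF : continuous F.
  by move=> x; apply/differentiable_continuous/derivable1_diffP; case: (dF x).
have incFw x y : a <= x -> y <= b -> x < y -> F x < F y.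
  by move=> ax yb xy; apply: incF => //; rewrite in_itv/=; lra.
have leF x y : a <= x -> y <= b -> x <= y -> F x <= F y.
  by move=> ax yb; rewrite le_eqVlt => /orP[/eqP->//|h]; apply/ltW/incFw.
(* The substitution is made on segments that exhaust the open interval. The margin starts at a third
   of the length so that no segment is degenerate. *)
have [ep [ep0 ep3 epm epx]] : exists ep : nat -> R,
    [/\ forall n, 0 < ep n, forall n, ep n <= (b - a) / 3,
      forall n m, (n <= m)%N -> ep m <= ep n &
      forall e : R, 0 < e -> exists n, ep n < e].
  have ba : 0 < b - a by rewrite subr_gt0.
  exists (fun n => (b - a) / n.+3%:R); split=> [n|n|n m nm|e e0].
  - by rewrite divr_gt0// ltr0n.
  - by rewrite ler_pM2l// lef_pV2 ?posrE ?ltr0n// ler_nat.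
  - by rewrite ler_pM2l// lef_pV2 ?posrE ?ltr0n// ler_nat.
  - exists (Num.truncn ((b - a) / e)).
    rewrite ltr_pdivrMr ?ltr0n// mulrC -ltr_pdivrMr//.
    apply: (@lt_trans _ _ (Num.truncn ((b - a) / e)).+1%:R); last by rewrite ltr_nat.
    exact: truncnS_gt.
pose an n : R := a + ep n; pose bn n : R := b - ep n.
have abn n : [/\ a < an n, an n < bn n & bn n < b].
  by have := ep0 n; have := ep3 n; rewrite /an /bn => h1 h2; split; lra.
have mono n m : (n <= m)%N -> an m <= an n /\ bn n <= bn m.
  by move=> /epm; rewrite /an /bn; split; lra.
have exn x : a < x < b -> exists n, an n <= x <= bn n.
  move=> /andP[ax xb]; pose e : R := Num.min (x - a) (b - x).
  have e0 : 0 < e by rewrite lt_min; lra.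
  have [ea eb] : e <= x - a /\ e <= b - x by split; rewrite ge_min lexx ?orbT.
  by have [n hn] := epx _ e0; exists n; rewrite /an /bn; lra.
(* Monotone convergence on both sides, possible since [G] and [H] are nonnegative; the two limits
   agree because the integrals agree at every stage. *)
have cvgH : (\int[mu]_(x in `[an n, bn n]) (H x)%:E)%E @[n --> \oo] -->
    (\int[mu]_(x in `]a, b[) (H x)%:E)%E.
  have -> : `]a, b[%classic = \bigcup_n `[an n, bn n]%classic.
    apply/seteqP; split=> [x /=|x [n _] /=]; rewrite !in_itv/=.
      by move=> /exn[n xn]; exists n => //=; rewrite in_itv.
    by have [] := abn n; lra.
  apply: ge0_nondecreasing_set_cvg_integral => //.
  - move=> n m nm; apply/subsetPset; apply: subset_itv; rewrite bnd_simp; by case: (mono n m nm).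
  - move=> n; apply/measurable_EFinP/measurable_funTS.
    exact: continuous_measurable_fun.
  - by move=> n x /=; rewrite in_itv/= lee_fin => xn; apply: H0; have [] := abn n; lra.
have Fan n : [/\ F a < F (an n), F (an n) < F (bn n) & F (bn n) < F b].
  by have [? ? ?] := abn n; split; apply: incFw; lra.
have cvgG : (\int[mu]_(x in `[F (an n), F (bn n)]) (G x)%:E)%E @[n --> \oo] -->
    (\int[mu]_(x in `]F a, F b[) (G x)%:E)%E.
  have -> : `]F a, F b[%classic = \bigcup_n `[F (an n), F (bn n)]%classic.
    apply/seteqP; split=> [y /=|y [n _] /=]; rewrite !in_itv/=.
      (* The images of the segments exhaust the image interval because [F] attains every
         intermediate value. *)
      move=> yab.
      have [|x] := @IVT _ F a b y (ltW ab) (continuous_subspaceT cF).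
        have FaFb : F a < F b by apply: incFw.
        by rewrite min_l ?max_r ?(ltW FaFb)//; lra.
      rewrite in_itv/= => xab xy.
      have xab' : a < x < b.
        have : x != a by apply/eqP => xa; move: yab; rewrite -xy xa; lra.
        have : x != b by apply/eqP => xa; move: yab; rewrite -xy xa; lra.
        by move: xab => /andP[h1 h2] h3 h4; rewrite !lt_neqAle h1 h2 h3 eq_sym h4.
      have [n /andP[xn1 xn2]] := exn _ xab'; exists n => //=; rewrite in_itv/= -xy.
      have [? ? ?] := abn n.
      by apply/andP; split; apply: leF; lra.
    by have [] := Fan n; lra.
  apply: ge0_nondecreasing_set_cvg_integral => //.
  - move=> n m nm; apply/subsetPset; apply: subset_itv; rewrite bnd_simp.
      by apply: leF; have [] := mono n m nm; have [] := abn m; have [] := abn n; lra.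
    by apply: leF; have [] := mono n m nm; have [] := abn m; have [] := abn n; lra.
  - move=> n; apply/measurable_EFinP.
    apply: subspace_continuous_measurable_fun => //.
    apply: continuous_in_subspaceT => y; rewrite inE/= in_itv/= => yn.
    by apply: cG; rewrite in_itv/=; have [] := Fan n; lra.
  - by move=> n x /=; rewrite in_itv/= lee_fin => xn; apply: G0; have [] := Fan n; lra.
have eqn n : (\int[mu]_(x in `[F (an n), F (bn n)]) (G x)%:E =
    \int[mu]_(x in `[an n, bn n]) (H x)%:E)%E.
  have [h1 h2 h3] := abn n.
  have dFE : derive1 F = f by apply/funext => x; rewrite derive1E; case: (dF x).
  rewrite (@integration_by_substitution_increasing _ F G (an n) (bn n)) ?(ltW h2)//.
  - apply: eq_integral => x; rewrite inE/= in_itv/= => xn; rewrite dFE.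
    by rewrite HE//; lra.
  - by move=> x y; rewrite !in_itv/= => xn yn xy; apply: incFw; lra.
  - by rewrite dFE => x _; exact: cf.
  - by rewrite dFE; apply/cvg_ex; exists (f (an n)); apply: cvg_at_right_filter; exact: cf.
  - by rewrite dFE; apply/cvg_ex; exists (f (bn n)); apply: cvg_at_left_filter; exact: cf.
  - split; first by move=> x _; case: (dF x).
    + by apply: cvg_at_right_filter; exact: cF.
    + by apply: cvg_at_left_filter; exact: cF.
  - apply: continuous_in_subspaceT => y; rewrite inE/= in_itv/= => yn.
    by apply: cG; rewrite in_itv/=; have [] := Fan n; lra.
rewrite /sint /Rintegral; congr fine.
rewrite (@integral_itv_bndoo _ a b (EFin \o H) true false); last first.
  by apply/measurable_EFinP/measurable_funTS; exact: continuous_measurable_fun.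
move: cvgG; rewrite (_ : (fun n => _) = (fun n => \int[mu]_(x in `[an n, bn n]) (H x)%:E)%E).
  by move=> cvgG; exact: (cvg_unique _ cvgG cvgH).
by apply/funext => n; exact: eqn.
Qed.

End OpenSubstitution.

(** * Mean value estimates *)

Section MeanValue.
Context {R : realType}.

Lemma mean_value (f f1 : R -> R) (lo hi y y' : R) :
  (forall z, lo <= z <= hi -> is_derive z 1 f (f1 z)) ->
  lo <= y <= hi -> lo <= y' <= hi ->
  exists z, [/\ lo <= z <= hi, `|z - y| <= `|y' - y| & f y' - f y = f1 z * (y' - y)].
Proof.
move=> df ylh ylh'.
have aux u v : lo <= u <= hi -> lo <= v <= hi -> u <= v ->
    exists2 z, u <= z <= v & f v - f u = f1 z * (v - u).
  move=> ul vl uv; have [||z] := @MVT_segment _ f f1 u v uv.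
  - by move=> z; rewrite in_itv/= => zuv; apply: df; lra.
  - apply: continuous_in_subspaceT => z; rewrite inE/= in_itv/= => zuv.
    by apply: (drv_continuous _ _ (f1 z)); apply: df; lra.
  by rewrite in_itv/= => zuv ->; exists z.
have [yy|yy] := leP y y'.
  have [z zb ->] := aux _ _ ylh ylh' yy; exists z; split => //; first lra.
  by rewrite !ger0_norm; lra.
have [z zb e] := aux _ _ ylh' ylh (ltW yy); exists z; split; first lra.
  by rewrite !ler0_norm; lra.
by rewrite -opprB e; ring.
Qed.

Lemma derive_gt0_increasing (f f1 : R -> R) (lo hi y y' : R) :
  (forall z, lo < z < hi -> is_derive z 1 f (f1 z)) ->
  (forall z, lo < z < hi -> 0 < f1 z) ->
  lo < y -> y < y' -> y' < hi -> f y < f y'.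
Proof.
move=> df f10 ly yy yh.
have [z zb|||z [zb _ e]] := @mean_value f f1 y y' y y'; try lra.
  by apply: df; lra.
by rewrite -subr_gt0 e mulr_gt0 ?subr_gt0// f10//; lra.
Qed.

(** The mean value theorem is applied twice, to [f] and then to [f1]. The constant is M rather than
    M/2, which suffices for a remainder of second order. *)
Lemma taylor_order2 (f f1 f2 : R -> R) (lo hi M y y' : R) :
  (forall z, lo <= z <= hi -> is_derive z 1 f (f1 z)) ->
  (forall z, lo <= z <= hi -> is_derive z 1 f1 (f2 z)) ->
  (forall z, lo <= z <= hi -> `|f2 z| <= M) ->
  lo <= y <= hi -> lo <= y' <= hi ->
  `|f y' - f y - f1 y * (y' - y)| <= M * `|y' - y| ^+ 2.
Proof.
move=> df df1 bf2 yl yl'.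
have [z [zl zy ->]] := mean_value _ _ _ _ _ _ df yl yl'.
have [w [wl _ e]] := mean_value _ _ _ _ _ _ df1 yl zl.
rewrite -mulrBl e normrM normrM expr2 mulrA.
rewrite ler_wpM2r//; apply: ler_pM => //; exact: bf2.
Qed.

Lemma continuous_bounded_itv (f : R -> R) (lo hi : R) : lo <= hi ->
  (forall z, lo <= z <= hi -> {for z, continuous f}) ->
  exists2 M, 0 <= M & forall z, lo <= z <= hi -> `|f z| <= M.
Proof.
move=> lh cf.
have [|c _ cmax] := @EVT_max _ (fun z => `|f z|) lo hi lh.
  apply: continuous_in_subspaceT => z; rewrite inE/= in_itv/= => zlh.
  apply: (@continuous_comp _ _ _ f (fun y => `|y|)); first exact: cf.
  exact: norm_continuous.
by exists `|f c| => // z zlh; apply: cmax; rewrite in_itv.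
Qed.

End MeanValue.

(** * Weighted averages over a segment parametrised by sin^2 *)

Section SineAverage.
Context {R : realType}.
Implicit Types (f k : R -> R) (p q x : R).

Definition sin2 x : R := sin x ^+ 2.

Lemma sin2_itv x : 0 <= sin2 x <= 1.
Proof.
rewrite /sin2 sqr_ge0/= -(cos2Dsin2 x) lerDr sqr_ge0 //.
Qed.

Lemma is_derive_sin2 x : is_derive x 1 sin2 (2 * sin x * cos x).
Proof.
apply: (drv_eq _ _ _ _ (drvM _ _ _ _ _ (is_derive_sin x) (is_derive_sin x))).
by ring.
Qed.

Lemma continuous_sin2 : continuous sin2.
Proof. move=> x; exact: drv_continuous (is_derive_sin2 x). Qed.

Definition seg p q x := q + (p - q) * sin2 x.

(** A convex combination of [p] and [q] for every real [x] and for either order of [p] and [q]; this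
    is why integrands can be treated as continuous on the whole line. *)
Lemma seg_itv lo hi p q x : lo <= p <= hi -> lo <= q <= hi -> lo <= seg p q x <= hi.
Proof.
move=> /andP[p1 p2] /andP[q1 q2]; have /andP[s0 s1] := sin2_itv x; rewrite /seg.
have : 0 <= (p - lo) * sin2 x by rewrite mulr_ge0//; lra.
have : 0 <= (q - lo) * (1 - sin2 x) by rewrite mulr_ge0//; lra.
have : 0 <= (hi - p) * sin2 x by rewrite mulr_ge0//; lra.
have : 0 <= (hi - q) * (1 - sin2 x) by rewrite mulr_ge0//; lra.
lra.
Qed.

Lemma seg_itvoo lo hi p q x : lo < p < hi -> lo < q < hi -> lo < seg p q x < hi.
Proof.
move=> ph qh.
have [h1 h2] : Num.min p q <= p /\ Num.min p q <= q.
  by split; rewrite ge_min lexx ?orbT.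
have [h3 h4] : p <= Num.max p q /\ q <= Num.max p q.
  by split; rewrite le_max lexx ?orbT.
have h5 : lo < Num.min p q by rewrite lt_min; lra.
have h6 : Num.max p q < hi by rewrite gt_max; lra.
have /andP[] : Num.min p q <= seg p q x <= Num.max p q by apply: seg_itv; lra.
lra.
Qed.

Lemma is_derive_seg p q x : is_derive x 1 (seg p q) ((p - q) * (2 * sin x * cos x)).
Proof.
eapply drv_eq; first by drv_lambda ltac:(exact: is_derive_sin2).
by cbv beta; ring.
Qed.

Lemma continuous_seg p q : continuous (seg p q).
Proof. move=> x; exact: drv_continuous (is_derive_seg p q x). Qed.

(** The weight [k] makes the family closed under differentiation: a derivative in [p] multiplies it
    by sin^2, one in [q] by 1 - sin^2. *)
Definition savg f k p q : R := sint 0 (pi / 2) (fun x => f (seg p q x) * k x).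

Lemma continuous_savg (A : R) f k p q :
  (forall y, 0 < y < A -> {for y, continuous f}) -> continuous k ->
  0 < p < A -> 0 < q < A -> continuous (fun x => f (seg p q x) * k x).
Proof.
move=> cf ck pA qA x; apply: cvgM; last exact: ck.
apply: (@continuous_comp _ _ _ (seg p q) f); first exact: continuous_seg.
by apply: cf; exact: seg_itvoo.
Qed.

Lemma continuousM_fun f k : continuous f -> continuous k -> continuous (fun x => f x * k x).
Proof. by move=> cf ck x; apply: cvgM; [exact: cf|exact: ck]. Qed.

Lemma continuousZ_fun (r : R) f : continuous f -> continuous (fun x => r * f x).
Proof. by move=> cf x; apply: cvgM; [exact: cvg_cst|exact: cf]. Qed.

Lemma continuousD_fun f k : continuous f -> continuous k -> continuous (fun x => f x + k x).
Proof. by move=> cf ck x; apply: cvgD; [exact: cf|exact: ck]. Qed.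

Lemma continuousB_fun f k : continuous f -> continuous k -> continuous (fun x => f x - k x).
Proof. by move=> cf ck x; apply: cvgB; [exact: cf|exact: ck]. Qed.

Lemma continuous_1sin2 : continuous (fun x : R => 1 - sin2 x).
Proof. by move=> x; apply: cvgB; [exact: cvg_cst|exact: continuous_sin2]. Qed.

(** Differentiation under the integral sign without dominated convergence: the second-order Taylor
    remainder of [f] is uniform on a compact subinterval of ]0, A[ and is integrated against |k|. *)
Lemma savg_grad (A : R) f f1 f2 k p q :
  (forall y, 0 < y < A -> is_derive y 1 f (f1 y)) ->
  (forall y, 0 < y < A -> is_derive y 1 f1 (f2 y)) ->
  (forall y, 0 < y < A -> {for y, continuous f2}) ->
  continuous k -> 0 < p < A -> 0 < q < A ->
  grad (savg f k) p q (savg f1 (fun x => sin2 x * k x) p q)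
                      (savg f1 (fun x => (1 - sin2 x) * k x) p q).
Proof.
move=> df df1 cf2 ck pA qA e e0.
pose lo : R := Num.min p q / 2; pose hi : R := (Num.max p q + A) / 2.
have [h1 h2] : Num.min p q <= p /\ Num.min p q <= q.
  by split; rewrite ge_min lexx ?orbT.
have [h3 h4] : p <= Num.max p q /\ q <= Num.max p q.
  by split; rewrite le_max lexx ?orbT.
have h5 : 0 < Num.min p q by rewrite lt_min; lra.
have h6 : Num.max p q < A by rewrite gt_max; lra.
have lo0 : 0 < lo by rewrite /lo; lra.
have hiA : hi < A by rewrite /hi; lra.
have lohi : lo <= hi by rewrite /lo /hi; lra.
have sub z : lo <= z <= hi -> 0 < z < A by lra.
have [M M0 f2M] := continuous_bounded_itv f2 lo hi lohi (fun z h => cf2 z (sub z h)).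
have cak : continuous (fun x => `|k x|).
  move=> x; apply: (@continuous_comp _ _ _ k (fun y => `|y|)); first exact: ck.
  exact: norm_continuous.
pose C : R := sint 0 (pi / 2) (fun x => `|k x|).
have C0 : 0 <= C by apply: sint_ge0.
have MC : 0 <= M * C by rewrite mulr_ge0.
have cf y : 0 < y < A -> {for y, continuous f}.
  by move=> yA; exact: drv_continuous (df _ yA).
have cf1 y : 0 < y < A -> {for y, continuous f1}.
  by move=> yA; exact: drv_continuous (df1 _ yA).
(* The first two bounds keep [p'] and [q'] inside [lo, hi]; the third turns the quadratic error M C
   D^2 into at most e D. *)
exists (Num.min (Num.min lo (A - hi)) (e / (2 * (M * C + 1)))).
  by rewrite !lt_min lo0 subr_gt0 hiA/= divr_gt0// mulr_gt0//; lra.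
move=> p' q'; rewrite !lt_min => /andP[/andP[p1 p2] p3] /andP[/andP[q1 q2] q3].
have pl' : lo <= p' <= hi by move: p1 p2; rewrite !ltr_norml /lo /hi; lra.
have ql' : lo <= q' <= hi by move: q1 q2; rewrite !ltr_norml /lo /hi; lra.
have pl : lo <= p <= hi by rewrite /lo /hi; lra.
have ql : lo <= q <= hi by rewrite /lo /hi; lra.
set D := `|p' - p| + `|q' - q|.
have D0 : 0 <= D by rewrite addr_ge0.
have De : D <= e / (M * C + 1).
  have -> : e / (M * C + 1) = e / (2 * (M * C + 1)) + e / (2 * (M * C + 1)).
    by field; rewrite gt_eqF//; lra.
  by rewrite /D; lra.
have cs k' (ck' : continuous k') := continuous_savg A f1 _ p q cf1 ck' pA qA.
have ck1 : continuous (fun x => sin2 x * k x).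
  by apply: continuousM_fun => //; exact: continuous_sin2.
have ck2 : continuous (fun x => (1 - sin2 x) * k x).
  by apply: continuousM_fun => //; exact: continuous_1sin2.
have cp' := continuous_savg A f k p' q' cf ck (sub _ pl') (sub _ ql').
have cp := continuous_savg A f k p q cf ck pA qA.
rewrite /savg !(mulrC (sint _ _ (fun x => f1 _ * _))) -!sintZ; [|exact: cs|exact: cs].
rewrite -sintD; [|by apply: continuousZ_fun; exact: cs|by apply: continuousZ_fun; exact: cs].
rewrite -!sintB//; [|exact: continuousB_fun|by apply: continuousD_fun; apply: continuousZ_fun; exact: cs].
apply: (@le_trans _ _ (sint 0 (pi / 2) (fun x => M * D ^+ 2 * `|k x|))).
  apply: normr_sint_le.
  - by apply: continuousB_fun; [exact: continuousB_fun|by apply: continuousD_fun; apply: continuousZ_fun; exact: cs].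
  - exact: continuousZ_fun.
  move=> x _.
  have -> : f (seg p' q' x) * k x - f (seg p q x) * k x -
      ((p' - p) * (f1 (seg p q x) * (sin2 x * k x)) +
       (q' - q) * (f1 (seg p q x) * ((1 - sin2 x) * k x))) =
      (f (seg p' q' x) - f (seg p q x) -
         f1 (seg p q x) * (seg p' q' x - seg p q x)) * k x.
    by rewrite /seg; ring.
  rewrite normrM ler_wpM2r//.
  have := taylor_order2 f f1 f2 lo hi M (seg p q x) (seg p' q' x)
    (fun z h => df z (sub z h)) (fun z h => df1 z (sub z h)) f2M
    (seg_itv lo hi p q x pl ql) (seg_itv lo hi p' q' x pl' ql').
  move/le_trans; apply; rewrite ler_wpM2l// lerXn2r ?nnegrE//.
  have -> : seg p' q' x - seg p q x = (p' - p) * sin2 x + (q' - q) * (1 - sin2 x).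
    by rewrite /seg; ring.
  have /andP[s0 s1] := sin2_itv x.
  apply: (le_trans (ler_normD _ _)); rewrite (normrM (p' - p)) (normrM (q' - q)) (ger0_norm s0).
  rewrite (ger0_norm (_ : 0 <= 1 - sin2 x)) ?subr_ge0// /D.
  by apply: lerD; rewrite ler_piMr//; lra.
rewrite sintZ// -/C -/D expr2.
have -> : M * (D * D) * C = D * (M * C) * D by ring.
rewrite ler_wpM2r//.
apply: (@le_trans _ _ (e / (M * C + 1) * (M * C))); first by rewrite ler_wpM2r.
rewrite mulrAC ler_pdivrMr; last lra.
by rewrite ler_wpM2l// ?(ltW e0)//; lra.
Qed.

End SineAverage.

(** * The weight function phi and the signs of its derivatives *)

Section Weight.
Context {R : realType}.
Variable A : R.
Implicit Type y : R.

(* With X = 1/y and Y = 1/(A - y) one has X' = -X^2, Y' = Y^2 and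
   phi' = phi * (X + Y) / 2, which generates the formulas below. *)
Definition phi y : R := Num.sqrt (y / (A - y)).
Definition phi1 y : R := phi y * ((y^-1 + (A - y)^-1) / 2).
Definition phi2 y : R :=
  phi y * ((y^-1 + (A - y)^-1) * (3 * (A - y)^-1 - y^-1) / 4).
Definition phi3 y : R :=
  phi y * ((y^-1 + (A - y)^-1) *
    (15 * ((A - y)^-1 * (A - y)^-1) - 6 * (y^-1 * (A - y)^-1) + 3 * (y^-1 * y^-1)) / 8).
Definition phi4 y : R :=
  phi y * ((y^-1 + (A - y)^-1) *
   ((3 * (A - y)^-1 - y^-1) / 2 *
    ((15 * ((A - y)^-1 * (A - y)^-1) - 6 * (y^-1 * (A - y)^-1) + 3 * (y^-1 * y^-1)) / 8) +
    (30 * ((A - y)^-1 * (A - y)^-1 * (A - y)^-1) + 6 * (y^-1 * y^-1 * (A - y)^-1)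
     - 6 * (y^-1 * (A - y)^-1 * (A - y)^-1) - 6 * (y^-1 * y^-1 * y^-1)) / 8)).

Lemma phi_gt0 y : 0 < y < A -> 0 < phi y.
Proof. by move=> yA; rewrite sqrtr_gt0 divr_gt0//; lra. Qed.

Lemma phi_sqr y : 0 < y < A -> phi y ^+ 2 = y / (A - y).
Proof. by move=> yA; rewrite sqr_sqrtr// divr_ge0//; lra. Qed.

(** Every derivative of [phi] is [phi] times a rational function, so one product rule, with phi'/phi
    already inserted, reduces the higher derivatives to rational calculus. *)
Lemma is_derive_phiM (g : R -> R) (g' y : R) : 0 < y < A -> drv g y g' ->
  drv (fun z => phi z * g z) y
    (phi y * ((y^-1 + (A - y)^-1) / 2 * g y + g')).
Proof.
move=> yA dg; have y0 : y != 0 by rewrite gt_eqF//; lra.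
have Ay : A - y != 0 by rewrite gt_eqF//; lra.
have yy : 0 < y / (A - y) by rewrite divr_gt0//; lra.
have d1 : drv (fun z => z / (A - z)) y (A / (A - y) ^+ 2).
  eapply drv_eq; first by drv_lambda ltac:(eapply drvV; first exact: Ay).
  by cbv beta; field.
have dphi := drv_comp Num.sqrt (fun z => z / (A - z)) y _ _ (is_derive1_sqrt yy) d1.
apply: (drv_eq _ _ _ _ (drvM _ _ _ _ _ dphi dg)).
rewrite -/(phi y).
have p0 : phi y != 0 by rewrite gt_eqF// phi_gt0.
have -> : (2 * phi y)^-1 = phi y * (A - y) / (2 * y).
  have -> : (2 * phi y)^-1 = phi y / (2 * phi y ^+ 2) by field.
  by rewrite phi_sqr//; field; rewrite Ay y0.
by field; rewrite Ay y0.
Qed.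

Lemma is_derive_inv y : y != 0 -> drv (fun z : R => z^-1) y (- (y^-1 * y^-1)).
Proof.
move=> y0; eapply drv_eq; first by eapply drvV; [exact: y0|exact: drv_id].
by rewrite /=; field.
Qed.

Lemma is_derive_invB y : A - y != 0 ->
  drv (fun z : R => (A - z)^-1) y ((A - y)^-1 * (A - y)^-1).
Proof.
move=> y0; eapply drv_eq; first by drv_lambda ltac:(eapply drvV; first exact: y0).
by cbv beta; field.
Qed.

Local Ltac derive_XY y0 Ay :=
  drv_lambda ltac:(first [exact: (is_derive_inv _ y0) | exact: (is_derive_invB _ Ay)]).

Lemma is_derive_phi y : 0 < y < A -> is_derive y 1 phi (phi1 y).
Proof.
move=> yA; have := is_derive_phiM _ _ _ yA (drv_cst 1 y).
rewrite (_ : (fun z => phi z * 1) = phi); last by apply/funext => z; rewrite mulr1.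
by move=> h; apply: (drv_eq _ _ _ _ h); rewrite /phi1; ring.
Qed.

Lemma is_derive_phi1 y : 0 < y < A -> is_derive y 1 phi1 (phi2 y).
Proof.
move=> yA; have y0 : y != 0 by rewrite gt_eqF//; lra.
have Ay : A - y != 0 by rewrite gt_eqF//; lra.
eapply drv_eq; first by eapply is_derive_phiM; [exact: yA|derive_XY y0 Ay].
by cbv beta; rewrite /phi2; field; rewrite Ay y0.
Qed.

Lemma is_derive_phi2 y : 0 < y < A -> is_derive y 1 phi2 (phi3 y).
Proof.
move=> yA; have y0 : y != 0 by rewrite gt_eqF//; lra.
have Ay : A - y != 0 by rewrite gt_eqF//; lra.
eapply drv_eq; first by eapply is_derive_phiM; [exact: yA|derive_XY y0 Ay].
by cbv beta; rewrite /phi3; field; rewrite Ay y0.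
Qed.

Lemma is_derive_phi3 y : 0 < y < A -> is_derive y 1 phi3 (phi4 y).
Proof.
move=> yA; have y0 : y != 0 by rewrite gt_eqF//; lra.
have Ay : A - y != 0 by rewrite gt_eqF//; lra.
eapply drv_eq; first by eapply is_derive_phiM; [exact: yA|derive_XY y0 Ay].
by cbv beta; rewrite /phi4; field; rewrite Ay y0.
Qed.

Lemma continuous_phi4 y : 0 < y < A -> {for y, continuous phi4}.
Proof.
move=> yA; have y0 : y != 0 by rewrite gt_eqF//; lra.
have Ay : A - y != 0 by rewrite gt_eqF//; lra.
by eapply drv_continuous, is_derive_phiM; [exact: yA|derive_XY y0 Ay].
Qed.

Lemma continuous_phi y : 0 < y < A -> {for y, continuous phi}.
Proof. by move=> yA; exact: drv_continuous (is_derive_phi _ yA). Qed.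

Lemma continuous_phi1 y : 0 < y < A -> {for y, continuous phi1}.
Proof. by move=> yA; exact: drv_continuous (is_derive_phi1 _ yA). Qed.

Lemma continuous_phi2 y : 0 < y < A -> {for y, continuous phi2}.
Proof. by move=> yA; exact: drv_continuous (is_derive_phi2 _ yA). Qed.

Lemma continuous_phi3 y : 0 < y < A -> {for y, continuous phi3}.
Proof. by move=> yA; exact: drv_continuous (is_derive_phi3 _ yA). Qed.

Lemma phi1_gt0 y : 0 < y < A -> 0 < phi1 y.
Proof.
move=> yA; rewrite mulr_gt0 ?phi_gt0// divr_gt0// addr_gt0// invr_gt0; lra.
Qed.

(** With X = 1/y and Y = 1/(A - y) one has 3Y - X = 4XY(y - A/4). This is where the threshold A/4 of
    the theorem comes from. *)
Lemma phi2_sgE y : 0 < y < A ->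
  phi2 y = phi y * ((y^-1 + (A - y)^-1) * (y^-1 * (A - y)^-1)) * (y - A / 4).
Proof.
move=> yA; have y0 : y != 0 by rewrite gt_eqF//; lra.
have Ay : A - y != 0 by rewrite gt_eqF//; lra.
by rewrite /phi2; field; rewrite Ay y0.
Qed.

Lemma phi2_fac_gt0 y : 0 < y < A ->
  0 < phi y * ((y^-1 + (A - y)^-1) * (y^-1 * (A - y)^-1)).
Proof.
move=> yA; have X0 : 0 < y^-1 by rewrite invr_gt0; lra.
have Y0 : 0 < (A - y)^-1 by rewrite invr_gt0; lra.
by rewrite mulr_gt0 ?phi_gt0// mulr_gt0 ?addr_gt0// mulr_gt0.
Qed.

Lemma phi2_gt0 y : A / 4 < y < A -> 0 < y -> 0 < phi2 y.
Proof.
move=> yA y0; rewrite phi2_sgE; last lra.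
by rewrite mulr_gt0 ?phi2_fac_gt0//; lra.
Qed.

Lemma phi2_ge0 y : A / 4 <= y < A -> 0 < y -> 0 <= phi2 y.
Proof.
move=> yA y0; rewrite phi2_sgE; last lra.
by rewrite mulr_ge0 ?(ltW (phi2_fac_gt0 _ _))//; lra.
Qed.

Lemma phi2_lt0 y : 0 < y < A / 4 -> 0 < A -> phi2 y < 0.
Proof.
move=> yA A0; rewrite phi2_sgE; last lra.
by rewrite pmulr_rlt0 ?phi2_fac_gt0//; lra.
Qed.

Lemma phi2_le0 y : 0 < y <= A / 4 -> 0 < A -> phi2 y <= 0.
Proof.
move=> yA A0; rewrite phi2_sgE; last lra.
by rewrite pmulr_rle0 ?phi2_fac_gt0//; lra.
Qed.

Lemma phi3_gt0 y : 0 < y < A -> 0 < phi3 y.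
Proof.
move=> yA; have X0 : 0 < y^-1 by rewrite invr_gt0; lra.
have Y0 : 0 < (A - y)^-1 by rewrite invr_gt0; lra.
rewrite mulr_gt0 ?phi_gt0// divr_gt0// mulr_gt0 ?(addr_gt0 X0 Y0)//.
set X := y^-1 in X0 *; set Y := (A - y)^-1 in Y0 *.
(* Completing the square shows that the quadratic form is positive definite. *)
have -> : 15 * (Y * Y) - 6 * (X * Y) + 3 * (X * X) = 3 * (X - Y) ^+ 2 + 12 * (Y * Y) by ring.
by have := sqr_ge0 (X - Y); have := mulr_gt0 Y0 Y0; lra.
Qed.

Lemma phi_lt y y' : 0 < y -> y < y' -> y' < A -> phi y < phi y'.
Proof.
exact: (derive_gt0_increasing phi phi1 0 A y y' is_derive_phi phi1_gt0).
Qed.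

Lemma phi2_lt y y' : 0 < y -> y < y' -> y' < A -> phi2 y < phi2 y'.
Proof.
exact: (derive_gt0_increasing phi2 phi3 0 A y y' is_derive_phi2 phi3_gt0).
Qed.

Lemma phi_unbounded N : 0 < A -> exists p0, 0 < p0 < A /\ forall y, p0 < y < A -> N <= phi y.
Proof.
(* This is the solution of p0 / (A - p0) = N^2 + 1. *)
move=> A0; pose p0 : R := A * (N ^+ 2 + 1) / (N ^+ 2 + 2).
have N0 : 0 <= N ^+ 2 by rewrite sqr_ge0.
exists p0; split.
  rewrite divr_gt0 ?mulr_gt0//=; try lra.
  by rewrite ltr_pdivrMr ?ltr_pM2l//; lra.
move=> y /andP[py yA].
have h : A * (N ^+ 2 + 1) < y * (N ^+ 2 + 2) by rewrite -ltr_pdivrMr//; lra.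
have y0 : 0 < y.
  by apply: lt_trans py; rewrite divr_gt0 ?mulr_gt0//; lra.
apply: (le_trans (ler_norm N)); rewrite -sqrtr_sqr ler_wsqrtr//.
rewrite ler_pdivlMr; last lra.
nra.
Qed.

End Weight.

(** * The averages J, K and their derivatives: identities, signs and growth *)

Section Averages.
Context {R : realType}.
Variable A : R.
Implicit Types (p q x : R) (f k : R -> R).

Local Notation phi := (phi A).
Local Notation phi1 := (phi1 A).
Local Notation phi2 := (phi2 A).
Local Notation phi3 := (phi3 A).

(* [J] is half of the integral I; the other functions are its partial derivatives
   ([K] the mixed one, and [Kp], [Kq] those of [K]). *)
Definition J : R -> R -> R := savg phi (fun=> 1).
Definition Jp : R -> R -> R := savg phi1 (fun x => sin2 x * 1).
Definition Jq : R -> R -> R := savg phi1 (fun x => (1 - sin2 x) * 1).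
Definition Jpp : R -> R -> R := savg phi2 (fun x => sin2 x * (sin2 x * 1)).
Definition K : R -> R -> R := savg phi2 (fun x => (1 - sin2 x) * (sin2 x * 1)).
Definition Kp : R -> R -> R :=
  savg phi3 (fun x => sin2 x * ((1 - sin2 x) * (sin2 x * 1))).
Definition Kq : R -> R -> R :=
  savg phi3 (fun x => (1 - sin2 x) * ((1 - sin2 x) * (sin2 x * 1))).

Lemma continuous_cst1 : continuous (fun _ : R => 1 : R).
Proof. by move=> x; exact: cvg_cst. Qed.

Lemma continuous_kp : continuous (fun x : R => sin2 x * 1).
Proof. apply: continuousM_fun; [exact: continuous_sin2|exact: continuous_cst1]. Qed.

Lemma continuous_kq : continuous (fun x : R => (1 - sin2 x) * 1).
Proof. apply: continuousM_fun; [exact: continuous_1sin2|exact: continuous_cst1]. Qed.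

Lemma continuous_kpp : continuous (fun x : R => sin2 x * (sin2 x * 1)).
Proof. apply: continuousM_fun; [exact: continuous_sin2|exact: continuous_kp]. Qed.

Lemma continuous_kpq : continuous (fun x : R => (1 - sin2 x) * (sin2 x * 1)).
Proof. apply: continuousM_fun; [exact: continuous_1sin2|exact: continuous_kp]. Qed.

Lemma continuous_kppq : continuous (fun x : R => sin2 x * ((1 - sin2 x) * (sin2 x * 1))).
Proof. apply: continuousM_fun; [exact: continuous_sin2|exact: continuous_kpq]. Qed.

Lemma continuous_kpqq :
  continuous (fun x : R => (1 - sin2 x) * ((1 - sin2 x) * (sin2 x * 1))).
Proof. apply: continuousM_fun; [exact: continuous_1sin2|exact: continuous_kpq]. Qed.

Lemma J_grad p q : 0 < p < A -> 0 < q < A -> grad J p q (Jp p q) (Jq p q).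
Proof.
apply: savg_grad; [exact: is_derive_phi|exact: is_derive_phi1|
  exact: continuous_phi2|exact: continuous_cst1].
Qed.

Lemma Jp_grad p q : 0 < p < A -> 0 < q < A -> grad Jp p q (Jpp p q) (K p q).
Proof.
apply: savg_grad; [exact: is_derive_phi1|exact: is_derive_phi2|
  exact: continuous_phi3|exact: continuous_kp].
Qed.

Lemma K_grad p q : 0 < p < A -> 0 < q < A -> grad K p q (Kp p q) (Kq p q).
Proof.
apply: savg_grad; [exact: is_derive_phi2|exact: is_derive_phi3|
  exact: continuous_phi4|exact: continuous_kpq].
Qed.

Lemma pihalf_gt0 : 0 < pi / 2 :> R.
Proof. by rewrite divr_gt0// pi_gt0. Qed.

Lemma sin2_itvoo x : 0 < x < pi / 2 -> 0 < sin2 x < 1.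
Proof.
move=> xpi; rewrite /sin2 exprn_gt0 ?sin_gt0_pihalf//= -(cos2Dsin2 x).
rewrite ltrDr exprn_gt0// cos_gt0_pihalf//; have := pihalf_gt0; lra.
Qed.

Lemma pifourth_itv : 0 < (pi / 4 : R) < pi / 2.
Proof. have := pi_gt0 R; lra. Qed.

Lemma sin2_pifourth : 0 < sin2 (pi / 4 : R) < 1.
Proof. exact: sin2_itvoo pifourth_itv. Qed.

Lemma kpq_ge0 x : 0 <= (1 - sin2 x) * (sin2 x * 1).
Proof.
have /andP[s0 s1] := sin2_itv x.
by apply: mulr_ge0; [rewrite subr_ge0|rewrite mulr1].
Qed.

Lemma kpq_gt0 : 0 < (1 - sin2 (pi / 4 : R)) * (sin2 (pi / 4 : R) * 1).
Proof.
have /andP[s0 s1] := sin2_pifourth.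
by apply: mulr_gt0; [rewrite subr_gt0|rewrite mulr1].
Qed.

(** Strict positivity is witnessed at pi/4, where sin^2 lies strictly between 0 and 1, so that each
    of the weights in use is positive there. *)
Lemma savg_gt0 f k p q :
  (forall y, 0 < y < A -> {for y, continuous f}) -> continuous k ->
  (forall y, 0 < y < A -> 0 < f y) -> (forall x, 0 <= k x) -> 0 < k (pi / 4) ->
  0 < p < A -> 0 < q < A -> 0 < savg f k p q.
Proof.
move=> cf ck f0 k0 kp pA qA; have xi := pifourth_itv.
apply: (@sint_gt0 _ _ _ _ (pi / 4)); first exact: pihalf_gt0.
- exact: continuous_savg cf ck pA qA.
- by move=> x _; rewrite mulr_ge0// ltW// f0// seg_itvoo.
- lra.
- by rewrite mulr_gt0// f0// seg_itvoo.
Qed.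

Lemma J_gt0 p q : 0 < p < A -> 0 < q < A -> 0 < J p q.
Proof.
by apply: savg_gt0 => //; [exact: continuous_phi|exact: continuous_cst1|exact: phi_gt0].
Qed.

Lemma Jp_gt0 p q : 0 < p < A -> 0 < q < A -> 0 < Jp p q.
Proof.
apply: savg_gt0; [exact: continuous_phi1|exact: continuous_kp|exact: phi1_gt0| |].
- by move=> x; have := sin2_itv x; lra.
- by have := sin2_pifourth; lra.
Qed.

Lemma Jq_gt0 p q : 0 < p < A -> 0 < q < A -> 0 < Jq p q.
Proof.
apply: savg_gt0; [exact: continuous_phi1|exact: continuous_kq|exact: phi1_gt0| |].
- by move=> x; have := sin2_itv x; lra.
- by have := sin2_pifourth; lra.
Qed.

Lemma Kp_gt0 p q : 0 < p < A -> 0 < q < A -> 0 < Kp p q.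
Proof.
apply: savg_gt0; [exact: continuous_phi3|exact: continuous_kppq|exact: phi3_gt0| |].
- by move=> x; have /andP[s0 _] := sin2_itv x; exact: mulr_ge0 s0 (kpq_ge0 x).
- by have /andP[s0 _] := sin2_pifourth; exact: mulr_gt0 s0 kpq_gt0.
Qed.

Lemma Kq_gt0 p q : 0 < p < A -> 0 < q < A -> 0 < Kq p q.
Proof.
apply: savg_gt0; [exact: continuous_phi3|exact: continuous_kpqq|exact: phi3_gt0| |].
- move=> x; have /andP[_ s1] := sin2_itv x.
  by apply: mulr_ge0 (kpq_ge0 x); rewrite subr_ge0.
- have /andP[_ s1] := sin2_pifourth.
  by apply: mulr_gt0 kpq_gt0; rewrite subr_gt0.
Qed.

(* Integrate the derivative of phi'(eta) sin cos over [0, pi/2]. *)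
Lemma Euler_Poisson_Darboux p q : 0 < p < A -> 0 < q < A ->
  Jp p q - Jq p q = 2 * (p - q) * K p q.
Proof.
move=> pA qA.
have cp := continuous_savg A _ _ p q (continuous_phi1 A) continuous_kp pA qA.
have cq := continuous_savg A _ _ p q (continuous_phi1 A) continuous_kq pA qA.
have cK := continuous_savg A _ _ p q (continuous_phi2 A) continuous_kpq pA qA.
apply/eqP; rewrite -subr_eq0 /Jp /Jq /K /savg -sintZ// -!sintB//.
- apply/eqP.
  rewrite (@sint_FTC2 _ _ _ _ (fun x => - (phi1 (seg p q x) * (sin x * cos x)))).
  + by rewrite cos_pihalf sin0; ring.
  + exact: pihalf_gt0.
  + by apply: continuousB_fun; [exact: continuousB_fun|exact: continuousZ_fun].
  move=> x; have sA : 0 < seg p q x < A by exact: seg_itvoo.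
  eapply drv_eq.
    eapply drvN; eapply drvM; last first.
      by eapply drvM; [exact: is_derive_sin|exact: is_derive_cos].
    eapply (drv_comp phi1); first exact: is_derive_phi1.
    exact: is_derive_seg.
  have c2 : cos x ^+ 2 = 1 - sin x ^+ 2 by rewrite cos2sin2.
  by rewrite /sin2; cbv beta; ring: c2.
- exact: continuousB_fun.
- exact: continuousZ_fun.
Qed.

Lemma K_lt p p' q : 0 < q < A -> 0 < p -> p < p' -> p' < A -> K p q < K p' q.
Proof.
move=> qA p0 pp pA.
have sp x : 0 < seg p q x < A by apply: seg_itvoo; lra.
have sp' x : 0 < seg p' q x < A by apply: seg_itvoo; lra.
have segE x : seg p' q x = seg p q x + (p' - p) * sin2 x by rewrite /seg; ring.
apply: (@lt_sint _ _ _ _ _ (pi / 4)); first exact: pihalf_gt0.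
- by apply: (continuous_savg A); [exact: continuous_phi2|exact: continuous_kpq|lra|lra].
- by apply: (continuous_savg A); [exact: continuous_phi2|exact: continuous_kpq|lra|lra].
- move=> x _; have /andP[s0 s1] := sin2_itv x.
  rewrite ler_wpM2r ?kpq_ge0//.
  have : seg p q x <= seg p' q x by rewrite segE lerDl mulr_ge0//; lra.
  rewrite le_eqVlt => /orP[/eqP->//|h]; apply/ltW/phi2_lt => //.
    by have := sp x; lra.
  by have := sp' x; lra.
- have := pifourth_itv; lra.
- have /andP[s0 s1] := sin2_pifourth.
  rewrite ltr_pM2r ?kpq_gt0//.
  have : seg p q (pi / 4) < seg p' q (pi / 4) by rewrite segE ltrDl mulr_gt0//; lra.
  move=> h; apply: phi2_lt => //.
    by have := sp (pi / 4); lra.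
  by have := sp' (pi / 4); lra.
Qed.

Lemma K_lt0 p q : 0 < q < A / 4 -> 0 < p <= A / 4 -> K p q < 0.
Proof.
move=> qA pA; rewrite -oppr_gt0 -mulN1r -sintZ; last first.
  by apply: (continuous_savg A); [exact: continuous_phi2|exact: continuous_kpq|lra|lra].
apply: (@sint_gt0 _ _ _ _ (pi / 4)); first exact: pihalf_gt0.
- apply: continuousZ_fun.
  by apply: (continuous_savg A); [exact: continuous_phi2|exact: continuous_kpq|lra|lra].
- move=> x _; have /andP[s0 s1] := sin2_itv x.
  rewrite mulN1r oppr_ge0 mulr_le0_ge0 ?kpq_ge0//.
  apply: phi2_le0; last lra.
  have /andP[h1 h2] : Num.min p q <= seg p q x <= A / 4.
    by apply: seg_itv; rewrite ge_min lexx ?orbT/=; lra.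
  by rewrite h2 (lt_le_trans _ h1)// lt_min; lra.
- have := pifourth_itv; lra.
(* For p = A/4 the integrand vanishes at the end of the segment; at pi/4 the share of q < A/4 keeps
   the argument strictly below A/4. *)
- have /andP[s0 s1] := sin2_pifourth.
  rewrite mulN1r oppr_gt0 pmulr_llt0 ?kpq_gt0//.
  apply: phi2_lt0; last lra.
  have /andP[-> _]/= : 0 < seg p q (pi / 4) < A by apply: seg_itvoo; lra.
  rewrite /seg.
  have : 0 < (A / 4 - q) * (1 - sin2 (pi / 4)) by rewrite mulr_gt0//; lra.
  have : 0 <= (A / 4 - p) * sin2 (pi / 4) by rewrite mulr_ge0//; lra.
  lra.
Qed.

(** The edge value q = A/4 lies outside the domain of the zero curve. Continuity of [K] carries this
    sign to nearby q and so confines the curve as q tends to A/4. *)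
Lemma K_gt0 p : A / 4 < p < A -> 0 < K p (A / 4).
Proof.
move=> pA; apply: (@sint_gt0 _ _ _ _ (pi / 4)); first exact: pihalf_gt0.
- by apply: (continuous_savg A); [exact: continuous_phi2|exact: continuous_kpq|lra|lra].
- move=> x _; have /andP[s0 s1] := sin2_itv x.
  rewrite mulr_ge0 ?kpq_ge0//.
  have /andP[h1 h2] : A / 4 <= seg p (A / 4) x <= p by apply: seg_itv; lra.
  by apply: phi2_ge0; lra.
- have := pifourth_itv; lra.
- have /andP[s0 s1] := sin2_pifourth.
  apply: mulr_gt0 kpq_gt0.
  have /andP[h1 h2] : A / 4 <= seg p (A / 4) (pi / 4) <= p by apply: seg_itv; lra.
  have h3 : 0 < (p - A / 4) * sin2 (pi / 4) by rewrite mulr_gt0//; lra.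
  by apply: phi2_gt0; move: h1 h2; rewrite /seg; lra.
Qed.

(* Chebyshev-type argument: phi'' changes sign exactly where sin2 = s0. *)
Lemma Jpp_gt0 p q : 0 < q < A / 4 -> A / 4 < p < A -> 0 <= K p q -> 0 < Jpp p q.
Proof.
move=> qA pA K0; pose s0 : R := (A / 4 - q) / (p - q).
have pq : 0 < p - q by lra.
have s00 : 0 < s0 by rewrite divr_gt0//; lra.
have s01 : s0 < 1 by rewrite ltr_pdivrMr//; lra.
have pA' : 0 < p < A by lra.
have qA' : 0 < q < A by lra.
have ck : continuous (fun x => sin2 x * (sin2 x - s0)).
  apply: continuousM_fun; first exact: continuous_sin2.
  by move=> x; apply: cvgB; [exact: continuous_sin2|exact: cvg_cst].
have cS := continuous_savg A _ _ p q (continuous_phi2 A) ck pA' qA'.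
have cpp := continuous_savg A _ _ p q (continuous_phi2 A) continuous_kpp pA' qA'.
have cpq := continuous_savg A _ _ p q (continuous_phi2 A) continuous_kpq pA' qA'.
have segE x : seg p q x - A / 4 = (p - q) * (sin2 x - s0).
  by rewrite /seg /s0; field; rewrite gt_eqF.
have S0 : 0 < savg phi2 (fun x => sin2 x * (sin2 x - s0)) p q.
  (* The witness is the endpoint pi/2, because the weight may vanish at pi/4 when s0 = 1/2. *)
  apply: (@sint_gt0 _ _ _ _ (pi / 2)) => //; first exact: pihalf_gt0.
  - move=> x _; have sA : 0 < seg p q x < A by exact: seg_itvoo.
    rewrite phi2_sgE// segE.
    have f0 := phi2_fac_gt0 A _ sA.
    set c := phi _ * _ in f0 *.
    have -> : c * ((p - q) * (sin2 x - s0)) * (sin2 x * (sin2 x - s0)) =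
      c * (p - q) * sin2 x * (sin2 x - s0) ^+ 2 by ring.
    have /andP[h _] := sin2_itv x.
    exact: (mulr_ge0 (mulr_ge0 (ltW (mulr_gt0 f0 pq)) h) (sqr_ge0 _)).
  - by rewrite lexx andbT ltW// pihalf_gt0.
  - have s1 : sin2 (pi / 2 : R) = 1 by rewrite /sin2 sin_pihalf expr1n.
    rewrite s1 mul1r mulr_gt0 ?subr_gt0// /seg s1 mulr1 addrC subrK.
    by apply: phi2_gt0; lra.
(* Pointwise, with s = sin^2 x: (1 - s0) s^2 = s0 (1 - s) s + s (s - s0). *)
have e : (1 - s0) * Jpp p q = s0 * K p q + savg phi2 (fun x => sin2 x * (sin2 x - s0)) p q.
  rewrite /Jpp /K /savg -!sintZ// -sintD//; last exact: continuousZ_fun.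
  by apply: eq_sint => x _; ring.
have : 0 < (1 - s0) * Jpp p q.
  by rewrite e ltr_wpDl// mulr_ge0// ltW.
by rewrite pmulr_rgt0// subr_gt0.
Qed.

(** The integrand is split at height A - d. Below, phi is at most phi(A - d); above, phi' >= phi /
    (2d) and sin^2 >= 1/2, so phi <= 4d phi' sin^2. *)
Lemma J_le_Jp p q d : 0 < q -> q < p < A -> 0 < d <= (A - q) / 2 ->
  J p q <= 4 * d * Jp p q + phi (A - d) * (pi / 2).
Proof.
move=> q0 pA dA; have pA' : 0 < p < A by lra.
have qA' : 0 < q < A by lra.
have cJ := continuous_savg A _ _ p q (continuous_phi A) continuous_cst1 pA' qA'.
have cp := continuous_savg A _ _ p q (continuous_phi1 A) continuous_kp pA' qA'.
have cc : continuous (fun _ : R => phi (A - d)) by move=> x; exact: cvg_cst.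
have -> : phi (A - d) * (pi / 2) = sint 0 (pi / 2) (fun=> phi (A - d)).
  by rewrite sint_cst ?subr0// ltW// pihalf_gt0.
rewrite /J /Jp /savg -sintZ// -sintD//; last exact: continuousZ_fun.
apply: le_sint => //; first by apply: continuousD_fun => //; exact: continuousZ_fun.
move=> x _; have /andP[s0 s1] := sin2_itv x.
have sA : 0 < seg p q x < A by exact: seg_itvoo.
have f0 := phi_gt0 A _ sA; have f10 := phi1_gt0 A _ sA.
have [h|h] := leP (seg p q x) (A - d).
  have : phi (seg p q x) <= phi (A - d).
    move: h; rewrite le_eqVlt => /orP[/eqP->//|h].
    by apply/ltW/phi_lt => //; lra.
  have : 0 <= 4 * d * (phi1 (seg p q x) * (sin2 x * 1)).
    have d4 : 0 <= 4 * d by lra.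
    by rewrite mulr1; exact: (mulr_ge0 d4 (mulr_ge0 (ltW f10) s0)).
  lra.
have f1 : phi (seg p q x) / (2 * d) <= phi1 (seg p q x).
  rewrite /phi1 invfM ler_pM2l// (mulrC 2^-1) ler_pM2r//.
  have X0 : 0 < (seg p q x)^-1 by rewrite invr_gt0; lra.
  have : d^-1 <= (A - seg p q x)^-1 by rewrite lef_pV2 ?posrE; lra.
  lra.
(* Since d <= (A - q)/2, a point above A - d is above (A + q)/2, hence above the midpoint of
   [q, p]. *)
have s2 : 1 / 2 <= sin2 x.
  have : (p - q) * (1 / 2) <= (p - q) * sin2 x by move: h; rewrite /seg; lra.
  by rewrite ler_pM2l//; lra.
have : phi (seg p q x) <= 4 * d * (phi1 (seg p q x) * (sin2 x * 1)).
  have -> : phi (seg p q x) = 4 * d * (phi (seg p q x) / (2 * d) * (1 / 2)).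
    by field; rewrite gt_eqF//; lra.
  rewrite mulr1 ler_pM2l; last lra.
  by apply: ler_pM => //; rewrite divr_ge0//; lra.
have : 0 < phi (A - d) by apply: phi_gt0; lra.
lra.
Qed.

(* Integrate the derivative of sin * phi(eta). *)
Lemma phi_le_J p q : 0 < q -> q < p < A -> phi p <= J p q + 2 * (p - q) * Jp p q.
Proof.
move=> q0 pA; have pA' : 0 < p < A by lra.
have qA' : 0 < q < A by lra.
have cJ := continuous_savg A _ _ p q (continuous_phi A) continuous_cst1 pA' qA'.
have cp := continuous_savg A _ _ p q (continuous_phi1 A) continuous_kp pA' qA'.
have c1 := continuous_savg A _ _ p q (continuous_phi A) (@continuous_cos R) pA' qA'.
have c2 := continuous_savg A _ _ p q (continuous_phi1 A)
  (continuousM_fun _ _ continuous_kp (@continuous_cos R)) pA' qA'.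
pose g x := phi (seg p q x) * cos x + 2 * (p - q) * (phi1 (seg p q x) * (sin2 x * 1 * cos x)).
have cg : continuous g by apply: continuousD_fun => //; exact: continuousZ_fun.
have -> : phi p = sint 0 (pi / 2) g.
  rewrite (@sint_FTC2 _ _ _ _ (fun x => phi (seg p q x) * sin x)).
  - by rewrite sin_pihalf sin0 mulr0 subr0 mulr1 /seg /sin2 sin_pihalf expr1n mulr1 addrC subrK.
  - exact: pihalf_gt0.
  - exact: cg.
  move=> x; have sA : 0 < seg p q x < A by exact: seg_itvoo.
  eapply drv_eq.
    eapply drvM; last exact: is_derive_sin.
    by eapply (drv_comp phi); [exact: is_derive_phi|exact: is_derive_seg].
  by rewrite /g /sin2; ring.
rewrite /J /Jp /savg -sintZ// -sintD//; last exact: continuousZ_fun.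
apply: le_sint => //; first by apply: continuousD_fun => //; exact: continuousZ_fun.
move=> x _; have /andP[s0 s1] := sin2_itv x.
have sA : 0 < seg p q x < A by exact: seg_itvoo.
have f0 := phi_gt0 A _ sA; have f10 := phi1_gt0 A _ sA.
have c0 := cos_le1 x.
apply: lerD; first by rewrite ler_pM2l.
rewrite ler_pM2l; last lra.
by rewrite ler_pM2l// ler_piMr//; lra.
Qed.

(** The weight 1 - sin^2 = (p - eta)/(p - q) cancels the factor 1/(A - eta) of phi', because p - eta
    <= A - eta. No such cancellation occurs in [Jp]. *)
Lemma Jq_le_J p q : 0 < q -> q < p < A -> Jq p q <= A / (2 * q * (p - q)) * J p q.
Proof.
move=> q0 pA; have pA' : 0 < p < A by lra.
have qA' : 0 < q < A by lra.
have cJ := continuous_savg A _ _ p q (continuous_phi A) continuous_cst1 pA' qA'.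
have cq := continuous_savg A _ _ p q (continuous_phi1 A) continuous_kq pA' qA'.
rewrite /J /Jq /savg -sintZ//.
apply: le_sint => //; first exact: continuousZ_fun.
move=> x _; have /andP[s0 s1] := sin2_itv x.
have /andP[h1 h2] : q <= seg p q x <= p by apply: seg_itv; lra.
have sA : 0 < seg p q x < A by lra.
have f0 := phi_gt0 A _ sA.
have Y0 : 0 < A - seg p q x by lra.
have y0 : 0 < seg p q x by lra.
rewrite /phi1 !mulr1 (mulrC _ (phi _)) -mulrA ler_pM2l//.
have -> : ((seg p q x)^-1 + (A - seg p q x)^-1) / 2 * (1 - sin2 x) =
   A / 2 * ((seg p q x)^-1 * ((1 - sin2 x) / (A - seg p q x))).
  by field; rewrite !gt_eqF.
have -> : A / (2 * q * (p - q)) = A / 2 * (q^-1 * (p - q)^-1).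
  by field; rewrite !gt_eqF//; lra.
rewrite ler_pM2l; last lra.
apply: ler_pM.
- by rewrite invr_ge0; lra.
- by rewrite divr_ge0//; lra.
- by rewrite lef_pV2 ?posrE.
- rewrite ler_pdivrMr// mulrC ler_pdivlMr; last lra.
  by rewrite /seg; lra.
Qed.

(** By [J_le_Jp], J <= (e/2) Jp + C with C independent of p; by [phi_le_J] and the unboundedness of
    phi, Jp itself grows until it absorbs C. *)
Lemma J_over_Jp_small q e : 0 < q < A -> 0 < e ->
  exists2 p0, q < p0 < A & forall p, p0 < p < A -> J p q <= e * Jp p q.
Proof.
move=> qA e0; pose d := Num.min ((A - q) / 2) (e / 8).
have d0 : 0 < d by rewrite lt_min; lra.
have [dA de] : d <= (A - q) / 2 /\ d <= e / 8 by split; rewrite ge_min lexx ?orbT.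
pose C := phi (A - d) * (pi / 2).
have C0 : 0 < C by rewrite mulr_gt0 ?pihalf_gt0// phi_gt0//; lra.
(* The threshold is chosen so that phi(p) <= C + (e/2 + 2A) Jp forces Jp >= 2C/e. *)
have [p1 [p1A p1P]] := phi_unbounded A (C + (e / 2 + 2 * A) * (2 * C / e)) ltac:(lra).
exists (Num.max p1 ((q + A) / 2)).
  by rewrite lt_max gt_max; lra.
move=> p; rewrite gt_max => /andP[/andP[pp1 pq] pA].
have Jp0 : 0 < Jp p q by apply: Jp_gt0; lra.
have h1 : J p q <= e / 2 * Jp p q + C.
  apply: (le_trans (J_le_Jp p q d _ _ _)); try lra.
  by rewrite lerD2r ler_pM2r//; lra.
have h2 : C + (e / 2 + 2 * A) * (2 * C / e) <= phi p by apply: p1P; lra.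
have h3 : phi p <= J p q + 2 * (p - q) * Jp p q by apply: phi_le_J; lra.
have h4 : 2 * (p - q) * Jp p q <= 2 * A * Jp p q by rewrite ler_pM2r//; lra.
have h5 : (e / 2 + 2 * A) * (2 * C / e) <= (e / 2 + 2 * A) * Jp p q by lra.
have h6 : 2 * C / e <= Jp p q by move: h5; rewrite ler_pM2l//; lra.
have h7 : C <= e / 2 * Jp p q.
  have -> : C = e / 2 * (2 * C / e) by field; rewrite gt_eqF.
  by rewrite ler_pM2l//; lra.
lra.
Qed.

(** Near p = A, [Jq] is bounded by a multiple of [J], which is small against [Jp]; so Jq < Jp, and
    [Euler_Poisson_Darboux] gives the sign. *)
Lemma K_gt0_near q : 0 < q < A ->
  exists2 p0, q < p0 < A & forall p, p0 < p < A -> 0 < K p q.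
Proof.
(* For p > (q + A)/2 the bound on [Jq] is at most A/(q(A - q)) J; this ratio makes it at most
   Jp/2. *)
move=> qA; have e0 : 0 < q * (A - q) / (2 * A).
  by rewrite divr_gt0// mulr_gt0//; lra.
have [p0 p0A p0P] := J_over_Jp_small q _ qA e0.
exists (Num.max p0 ((q + A) / 2)); first by rewrite lt_max gt_max; lra.
move=> p; rewrite gt_max => /andP[/andP[pp1 pq] pA].
have Jp0 : 0 < Jp p q by apply: Jp_gt0; lra.
have J0 : 0 < J p q by apply: J_gt0; lra.
have h1 : J p q <= q * (A - q) / (2 * A) * Jp p q by apply: p0P; lra.
have h2 : Jq p q <= A / (2 * q * (p - q)) * J p q by apply: Jq_le_J; lra.
have h3 : A / (2 * q * (p - q)) * J p q <= A / (q * (A - q)) * J p q.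
  rewrite ler_pM2r// ler_pM2l; last lra.
  rewrite lef_pV2 ?posrE; [|by rewrite !mulr_gt0//; lra|by rewrite !mulr_gt0//; lra].
  by rewrite (mulrC 2) -mulrA ler_pM2l; lra.
have h4 : A / (q * (A - q)) * J p q <= Jp p q / 2.
  have -> : Jp p q / 2 = A / (q * (A - q)) * (q * (A - q) / (2 * A) * Jp p q).
    by field; rewrite !gt_eqF//; lra.
  by rewrite ler_pM2l// divr_gt0 ?mulr_gt0//; lra.
have := Euler_Poisson_Darboux p q ltac:(lra) ltac:(lra).
have h5 : 0 < Jp p q - Jq p q by lra.
move=> e; move: h5; rewrite e pmulr_rgt0//; lra.
Qed.

(** On the diagonal the integrands see a constant argument, and [Euler_Poisson_Darboux] gives Jp =
    Jq, so [Jp] is half of phi'(y) pi/2. *)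
Lemma J_diag y : 0 < y < A -> J y y / Jp y y = 4 * y * (A - y) / A.
Proof.
move=> yA; have cp := continuous_savg A _ _ y y (continuous_phi1 A) continuous_kp yA yA.
have cq := continuous_savg A _ _ y y (continuous_phi1 A) continuous_kq yA yA.
have segyy x : seg y y x = y by rewrite /seg subrr mul0r addr0.
have e1 : J y y = phi y * (pi / 2).
  rewrite -[in RHS](subr0 (pi / 2)) -sint_cst; last by rewrite ltW// pihalf_gt0.
  by apply: eq_sint => x _; rewrite segyy mulr1.
have e2 : Jp y y + Jq y y = phi1 y * (pi / 2).
  rewrite -[in RHS](subr0 (pi / 2)) -sint_cst; last by rewrite ltW// pihalf_gt0.
  rewrite /Jp /Jq /savg -sintD//.
  by apply: eq_sint => x _; rewrite segyy; ring.
have := Euler_Poisson_Darboux y y yA yA; rewrite subrr mulr0 mul0r => e3.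
have -> : Jp y y = phi1 y * pi / 4 by lra.
rewrite e1 /phi1; have := phi_gt0 A y yA; have := pi_gt0 R => pi0 f0.
field; rewrite !gt_eqF//; try lra.
Qed.

End Averages.

(** * Shifted speeds, the curve K = 0, and monotonicity of the speed *)

Section Profiles.
Context {R : realType}.
Variable A : R.
Implicit Types p q xi : R.

Local Notation J := (J A).
Local Notation Jp := (Jp A).
Local Notation Jq := (Jq A).
Local Notation Jpp := (Jpp A).
Local Notation K := (K A).
Local Notation Kp := (Kp A).
Local Notation Kq := (Kq A).

(** The speed lambda_2 increased by nu: A + p + q carries three shifts by nu, the speed only two. *)
Definition l2 p q : R := A + p + q - J p q / Jp p q.
Definition l3 p q : R := A + p + q - J p q / Jq p q.

Lemma l2_eq_l3 p q : 0 < q -> q < p < A -> l2 p q = l3 p q <-> K p q = 0.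
Proof.
move=> q0 pA; have pA' : 0 < p < A by lra.
have qA' : 0 < q < A by lra.
have J0 := J_gt0 A _ _ pA' qA'; have Jp0 := Jp_gt0 A _ _ pA' qA'.
have Jq0 := Jq_gt0 A _ _ pA' qA'; have epd := Euler_Poisson_Darboux A _ _ pA' qA'.
split=> [e|K0].
  have /(mulfI (lt0r_neq0 J0))/invr_inj e1 : J p q / Jp p q = J p q / Jq p q.
    by move: e; rewrite /l2 /l3; lra.
  have : 2 * (p - q) * K p q = 0 by rewrite -epd e1 subrr.
  by move/eqP; rewrite mulf_eq0 gt_eqF ?orFb => [/eqP//|]; lra.
have e1 : Jp p q = Jq p q by move: epd; rewrite K0 mulr0; lra.
by rewrite /l2 /l3 e1.
Qed.

Lemma l2_lt_top p q : 0 < p < A -> 0 < q < A -> l2 p q < 2 * A + q.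
Proof.
move=> pA qA; have : 0 < J p q / Jp p q by rewrite divr_gt0 ?J_gt0 ?Jp_gt0.
by rewrite /l2; lra.
Qed.

Lemma K_cvg (T : Type) (F : set_system T) {FF : Filter F} (u v : T -> R) p q :
  0 < p < A -> 0 < q < A -> u x @[x --> F] --> p -> v x @[x --> F] --> q ->
  K (u x) (v x) @[x --> F] --> K p q.
Proof. by move=> pA qA; exact: grad_cvg (K_grad A _ _ pA qA). Qed.

Lemma l2_cvg (T : Type) (F : set_system T) {FF : Filter F} (u v : T -> R) p q :
  0 < p < A -> 0 < q < A -> u x @[x --> F] --> p -> v x @[x --> F] --> q ->
  l2 (u x) (v x) @[x --> F] --> l2 p q.
Proof.
move=> pA qA up vq; apply: cvgB.
  by apply: cvgD => //; apply: cvgD => //; exact: cvg_cst.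
apply: cvgM; first exact: grad_cvg (J_grad A _ _ pA qA) up vq.
apply: cvgV; first by rewrite gt_eqF// Jp_gt0.
exact: grad_cvg (Jp_grad A _ _ pA qA) up vq.
Qed.

Lemma l2_drv (u v : R -> R) x du dv : 0 < u x < A -> 0 < v x < A ->
  drv u x du -> drv v x dv ->
  drv (fun s => l2 (u s) (v s)) x
    (du + dv - ((Jp (u x) (v x) * du + Jq (u x) (v x) * dv) / Jp (u x) (v x) -
      J (u x) (v x) * (Jpp (u x) (v x) * du + K (u x) (v x) * dv) / Jp (u x) (v x) ^+ 2)).
Proof.
move=> uA vA hu hv.
have j0 : Jp (u x) (v x) != 0 by rewrite gt_eqF// Jp_gt0.
have dJ := grad_derive _ _ _ _ _ _ _ _ (J_grad A _ _ uA vA) hu hv.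
have dJp := grad_derive _ _ _ _ _ _ _ _ (Jp_grad A _ _ uA vA) hu hv.
rewrite /l2; eapply drv_eq.
  eapply drvD.
    eapply drvD; last exact: hv.
    by eapply drvD; [exact: drv_cst|exact: hu].
  eapply drvN; eapply drvM; first exact: dJ.
  by eapply drvV; [exact: j0|exact: dJp].
by cbv beta; field.
Qed.

Lemma K_root_exists q : 0 < q < A / 4 -> exists p, A / 4 < p < A /\ K p q = 0.
Proof.
move=> qA; have [p0 p0A p0P] := K_gt0_near A q ltac:(lra).
pose p1 : R := Num.max ((p0 + A) / 2) (A / 2).
have p1A : p1 < A by rewrite gt_max; lra.
have [p1p p1h] : (p0 + A) / 2 <= p1 /\ A / 2 <= p1.
  by split; rewrite le_max lexx ?orbT.
have K1 : 0 < K p1 q by apply: p0P; lra.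
have K0 : K (A / 4) q < 0 by apply: K_lt0; lra.
have [|||c] := @IVT _ (fun p => K p q) (A / 4) p1 0; first lra.
- apply: continuous_in_subspaceT => p; rewrite inE/= in_itv/= => pp.
  by apply: K_cvg; [lra|lra|exact: cvg_id|exact: cvg_cst].
- by rewrite min_l ?max_r; lra.
rewrite in_itv/= => cA Kc; exists c; split => //.
have : c != A / 4 by apply/eqP => e; move: K0; rewrite -e Kc ltxx.
by move: cA; rewrite lt_neqAle eq_sym => /andP[-> h] -> /=; lra.
Qed.

(** The default 0 is taken only where no root exists; for 0 < q < A/4 there is one. *)
Definition P q : R := xget 0 [set p | A / 4 < p < A /\ K p q = 0].

Lemma P_spec q : 0 < q < A / 4 -> A / 4 < P q < A /\ K (P q) q = 0.
Proof. by move=> /K_root_exists h; exact: (xgetPex 0 h). Qed.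

(** The sign of [K] locates a point relative to the curve, so that continuity of [P] can be read off
    from continuity of [K]. *)
Lemma K_lt0_P p q : 0 < q < A / 4 -> 0 < p < A -> (K p q < 0) = (p < P q).
Proof.
move=> qA pA; have [PA KP] := P_spec _ qA.
case: (ltgtP p (P q)) => [h|h|->]; last by rewrite KP ltxx.
  by rewrite -KP; apply: K_lt; lra.
by apply/negbTE; rewrite -leNgt ltW// -KP; apply: K_lt; lra.
Qed.

Lemma K_gt0_P p q : 0 < q < A / 4 -> 0 < p < A -> (0 < K p q) = (P q < p).
Proof.
move=> qA pA; have [PA KP] := P_spec _ qA.
case: (ltgtP p (P q)) => [h|h|->]; last by rewrite KP ltxx.
  by apply/negbTE; rewrite -leNgt ltW// -KP; apply: K_lt; lra.
by rewrite -KP; apply: K_lt; lra.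
Qed.

Lemma P_uniq p q : 0 < q < A / 4 -> 0 < p < A -> K p q = 0 -> p = P q.
Proof.
move=> qA pA Kpq; have := K_lt0_P _ _ qA pA; have := K_gt0_P _ _ qA pA.
by rewrite Kpq ltxx; case: ltgtP.
Qed.

Lemma P_continuous q : 0 < q < A / 4 -> {for q, continuous P}.
Proof.
move=> qA; have [PA KP] := P_spec _ qA.
apply/cvgrPdist_le => e e0.
(* Barriers on both sides of P q, clipped so that [K] is defined there. The strict signs of [K] at
   [p1] and [p2] persist for nearby x and trap P x. *)
pose p1 : R := Num.max (P q - e) (A / 4); pose p2 : R := Num.min (P q + e) ((P q + A) / 2).
have p1P : p1 < P q by rewrite gt_max; lra.
have p2P : P q < p2 by rewrite lt_min; lra.
have [h1 h2] : P q - e <= p1 /\ A / 4 <= p1 by split; rewrite le_max lexx ?orbT.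
have [h3 h4] : p2 <= P q + e /\ p2 <= (P q + A) / 2 by split; rewrite ge_min lexx ?orbT.
have K1 : K p1 q < 0 by rewrite K_lt0_P//; lra.
have K2 : 0 < K p2 q by rewrite K_gt0_P//; lra.
have c1 : K p1 x @[x --> q] --> K p1 q.
  by apply: K_cvg; [lra|lra|exact: cvg_cst|exact: cvg_id].
have c2 : K p2 x @[x --> q] --> K p2 q.
  by apply: K_cvg; [lra|lra|exact: cvg_cst|exact: cvg_id].
near=> x.
have x0 : 0 < x by near: x; apply: lt_nbhsr; lra.
have xA : x < A / 4 by near: x; apply: lt_nbhsl; lra.
have : p1 < P x.
  have := K_lt0_P p1 x ltac:(lra) ltac:(lra) => <-.
  by near: x; apply: (cvgr_lt _ c1).
have : P x < p2.
  have := K_gt0_P p2 x ltac:(lra) ltac:(lra) => <-.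
  by near: x; apply: (cvgr_gt _ c2).
by rewrite ler_norml; lra.
Unshelve. all: by end_near. Qed.

Definition dP q : R := - Kq (P q) q / Kp (P q) q.

Lemma dP_lt0 q : 0 < q < A / 4 -> dP q < 0.
Proof.
move=> qA; have [PA _] := P_spec _ qA.
by rewrite /dP mulNr oppr_lt0 divr_gt0 ?Kq_gt0 ?Kp_gt0//; lra.
Qed.

Lemma P_drv q : 0 < q < A / 4 -> drv P q (dP q).
Proof.
move=> qA; have [PA KP] := P_spec _ qA.
apply: (@grad_implicit _ K).
- by apply: K_grad; lra.
- by rewrite gt_eqF// Kp_gt0//; lra.
- exact: P_continuous.
near=> s; apply: (proj2 (P_spec s _)).
apply/andP; split; near: s; [apply: lt_nbhsr|apply: lt_nbhsl]; lra.
Unshelve. all: by end_near. Qed.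

(** Only an upper barrier is needed, since the curve stays above A/4. *)
Lemma P_cvg : 0 < A -> P q @[q --> (A / 4)^'-] --> A / 4.
Proof.
move=> A0.
apply/cvgrPdist_le => e e0.
pose p2 : R := Num.min (A / 4 + e) (A / 2).
have [h3 h4] : p2 <= A / 4 + e /\ p2 <= A / 2 by split; rewrite ge_min lexx ?orbT.
have h5 : A / 4 < p2 by rewrite lt_min; lra.
have K2 : 0 < K p2 (A / 4) by apply: K_gt0; lra.
have c2 : K p2 x @[x --> (A / 4)^'-] --> K p2 (A / 4).
  apply: K_cvg; [lra|lra|exact: cvg_cst|].
  by apply: cvg_at_left_filter; exact: cvg_id.
near=> x.
have x0 : 0 < x by near: x; apply: nbhs_left_gt; lra.
have xA : x < A / 4 by near: x; exact: nbhs_left_lt.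
have [PA _] := P_spec x ltac:(lra).
have : P x < p2.
  have := K_gt0_P p2 x ltac:(lra) ltac:(lra) => <-.
  by near: x; apply: (cvgr_gt _ c2).
by rewrite ler_norml; lra.
Unshelve. all: by end_near. Qed.

Definition L q : R := l2 (P q) q.

(** With Jp = Jq and K = 0 the terms of [l2_drv] cancel except the one in [Jpp]. *)
Definition dL q : R := J (P q) q * Jpp (P q) q / Jp (P q) q ^+ 2 * dP q.

(* On the curve K = 0 one has Jp = Jq, so l2 is stationary in its second argument. *)
Lemma L_drv q : 0 < q < A / 4 -> drv L q (dL q).
Proof.
move=> qA; have [PA KP] := P_spec _ qA.
have PA' : 0 < P q < A by lra.
have qA' : 0 < q < A by lra.
have epd := Euler_Poisson_Darboux A _ _ PA' qA'.
have e1 : Jq (P q) q = Jp (P q) q by move: epd; rewrite KP mulr0; lra.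
apply: (drv_eq _ _ _ _ (l2_drv P id q _ _ PA' qA' (P_drv _ qA) (drv_id q))).
rewrite /= e1 KP /dL; field.
by rewrite gt_eqF// Jp_gt0.
Qed.

Lemma dL_lt0 q : 0 < q < A / 4 -> dL q < 0.
Proof.
move=> qA; have [PA KP] := P_spec _ qA.
rewrite /dL pmulr_rlt0 ?dP_lt0//.
have j : 0 < Jpp (P q) q by apply: Jpp_gt0 => //; rewrite KP.
by rewrite divr_gt0 ?exprn_gt0 ?mulr_gt0 ?J_gt0 ?Jp_gt0//; lra.
Qed.

Lemma L_lt q q' : 0 < q -> q < q' -> q' < A / 4 -> L q' < L q.
Proof.
move=> q0 qq qA; rewrite -ltrN2.
apply: (@derive_gt0_increasing _ (fun s => - L s) (fun s => - dL s) 0 (A / 4)) => //.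
  by move=> z zA; exact: (drvN _ _ _ (L_drv _ zA)).
by move=> z zA; rewrite oppr_gt0 dL_lt0.
Qed.

Lemma L_inj q q' : 0 < q < A / 4 -> 0 < q' < A / 4 -> L q = L q' -> q = q'.
Proof.
move=> qA qA' e; case: (ltgtP q q') => // h.
  by have := L_lt q q' ltac:(lra) h ltac:(lra); rewrite e ltxx.
by have := L_lt q' q ltac:(lra) h ltac:(lra); rewrite e ltxx.
Qed.

Lemma L_cvg : 0 < A -> L q @[q --> (A / 4)^'-] --> 3 * A / 4.
Proof.
move=> A0.
(* The limit point is on the diagonal but inside the square where [l2] is continuous, so its value
   comes from [J_diag]. *)
have -> : 3 * A / 4 = l2 (A / 4) (A / 4).
  by rewrite /l2 J_diag; [field; rewrite gt_eqF|lra].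
apply: l2_cvg; [lra|lra|exact: P_cvg A0|].
by apply: cvg_at_left_filter; exact: cvg_id.
Qed.

Lemma L_gt q : 0 < q < A / 4 -> 3 * A / 4 < L q.
Proof.
move=> qA; have A0 : 0 < A by lra.
(* The limit alone gives a weak inequality; comparing with a point between q and A/4 makes it
   strict. *)
pose q1 := (q + A / 4) / 2.
have h : L q1 < L q by apply: L_lt; rewrite /q1; lra.
apply: le_lt_trans h.
apply: (cvgr_to_le (L_cvg A0)); near=> x; apply/ltW/L_lt.
- by rewrite /q1; lra.
- by near: x; apply: nbhs_left_gt; rewrite /q1; lra.
- by near: x; exact: nbhs_left_lt.
Unshelve. all: by end_near. Qed.

Lemma L_surj b xi : 0 < b < A / 4 -> 3 * A / 4 < xi <= L b ->
  exists2 q, b <= q < A / 4 & L q = xi.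
Proof.
move=> bA /andP[xi1 xi2]; have A0 : 0 < A by lra.
have [q1 [q1b q1A Lq1]] : exists q1, [/\ b < q1, q1 < A / 4 & L q1 < xi].
  near (A / 4)^'- => q1; exists q1; split; near: q1.
  - by apply: nbhs_left_gt; lra.
  - exact: nbhs_left_lt.
  - exact: (cvgr_lt _ (L_cvg A0)).
have [|||c] := @IVT _ L b q1 xi; first lra.
- apply: continuous_in_subspaceT => q; rewrite inE/= in_itv/= => qb.
  by apply: (drv_continuous _ _ _ (L_drv q _)); lra.
- by rewrite min_r ?max_l; lra.
by rewrite in_itv/= => cb <-; exists c => //; lra.
Unshelve. all: by end_near. Qed.

(** For fixed q the derivative in p is J Jpp / Jp^2, and [Jpp_gt0] applies because K >= 0 from P q
    onwards. *)
Lemma l2_lt p p' q : 0 < q < A / 4 -> P q <= p -> p < p' -> p' < A -> l2 p q < l2 p' q.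
Proof.
move=> qA Pp pp pA; have [PA KP] := P_spec _ qA.
pose f1 z := J z q * Jpp z q / Jp z q ^+ 2.
have qA' : 0 < q < A by lra.
have df z : p <= z <= p' -> drv (l2 ^~ q) z (f1 z).
  move=> zp; have zA : 0 < z < A by lra.
  apply: (drv_eq _ _ _ _ (l2_drv id (fun=> q) z _ _ zA qA' (drv_id z) (drv_cst q z))).
  by rewrite /f1/=; field; rewrite gt_eqF// Jp_gt0.
have [||z [zp _ e]] := mean_value _ _ p p' p p' df; [lra|lra|].
rewrite -subr_gt0 e mulr_gt0 ?subr_gt0//.
have zA : 0 < z < A by lra.
rewrite divr_gt0 ?exprn_gt0 ?mulr_gt0 ?J_gt0 ?Jp_gt0//.
apply: Jpp_gt0 => //; first lra.
by rewrite leNgt K_lt0_P// -leNgt; lra.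
Qed.

Lemma l2_surj b xi : 0 < b < A / 4 -> L b <= xi < 2 * A + b ->
  exists2 p, P b <= p < A & l2 p b = xi.
Proof.
move=> bA /andP[xi1 xi2]; have [PA KP] := P_spec _ bA.
have e0 : 0 < (2 * A + b - xi) / 2 by lra.
have [p0 p0A p0P] := J_over_Jp_small A b _ ltac:(lra) e0.
(* Of the gap 2A + b - xi, the ratio J/Jp uses at most a half and A - p1 at most a third, which
   leaves l2 p1 b above xi. *)
pose p1 : R := Num.max ((p0 + A) / 2) (Num.max ((P b + A) / 2) (A - (2 * A + b - xi) / 3)).
have p1A : p1 < A by rewrite !gt_max; lra.
have [h1 h2 h3] : [/\ (p0 + A) / 2 <= p1, (P b + A) / 2 <= p1 &
    A - (2 * A + b - xi) / 3 <= p1].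
  by split; rewrite !le_max lexx ?orbT.
have xi3 : xi < l2 p1 b.
  have : J p1 b / Jp p1 b <= (2 * A + b - xi) / 2.
    by rewrite ler_pdivrMr ?Jp_gt0 ?p0P//; lra.
  rewrite /l2; lra.
have [|||c] := @IVT _ (l2 ^~ b) (P b) p1 xi; first lra.
- apply: continuous_in_subspaceT => p; rewrite inE/= in_itv/= => pp.
  by apply: l2_cvg; [lra|lra|exact: cvg_id|exact: cvg_cst].
- by rewrite min_l ?max_r//; rewrite -/(L b); lra.
by rewrite in_itv/= => cb <-; exists c => //; lra.
Qed.

End Profiles.

(** * Inverting the speeds: profiles as functions of the shifted ratio *)

Section SelfSimilar.
Context {R : realType}.
Variables A b : R.
Hypothesis bA : 0 < b < A / 4.
Implicit Types p q xi : R.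

Local Notation l2 := (l2 A).
Local Notation l3 := (l3 A).
Local Notation P := (P A).
Local Notation L := (L A).

Let A0 : 0 < A. Proof. by move: bA; lra. Qed.

Definition Linv xi : R := xget 0 [set q | 0 < q < A / 4 /\ L q = xi].

Lemma LK q : 0 < q < A / 4 -> Linv (L q) = q.
Proof.
move=> qA; have [] := @xgetPex _ 0 [set q' | 0 < q' < A / 4 /\ L q' = L q].
  by exists q.
by move=> h e; exact: L_inj e.
Qed.

Lemma near_itvoo (lo hi x : R) : lo < x < hi -> \forall s \near x, lo < s < hi.
Proof.
move=> xlh; near=> s; apply/andP; split; near: s; [apply: lt_nbhsr|apply: lt_nbhsl]; lra.
Unshelve. all: by end_near. Qed.

Lemma Linv_drv q : 0 < q < A / 4 -> drv Linv (L q) (dL A q)^-1.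
Proof.
move=> qA; apply: is_derive_inverse; last by rewrite lt_eqF// dL_lt0.
- by near=> s; apply: LK; near: s; exact: near_itvoo.
- near=> s; apply: (drv_continuous _ _ _ (L_drv A s _)); near: s; exact: near_itvoo.
- exact: L_drv.
Unshelve. all: by end_near. Qed.

Definition l2inv xi : R := xget 0 [set p | P b <= p < A /\ l2 p b = xi].

Lemma l2_inj p p' : P b <= p < A -> P b <= p' < A -> l2 p b = l2 p' b -> p = p'.
Proof.
move=> pP pP' e; case: (ltgtP p p') => // h.
  by have := l2_lt A p p' b bA ltac:(lra) h ltac:(lra); rewrite e ltxx.
by have := l2_lt A p' p b bA ltac:(lra) h ltac:(lra); rewrite e ltxx.
Qed.

Lemma l2K p : P b <= p < A -> l2inv (l2 p b) = p.
Proof.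
move=> pA; have [] := @xgetPex _ 0 [set p' | P b <= p' < A /\ l2 p' b = l2 p b].
  by exists p.
by move=> h e; exact: l2_inj e.
Qed.

(** The point P b is excluded: the inverse is controlled only for p >= P b, so no full neighbourhood
    is available there. *)
Lemma l2inv_drv p : P b < p < A -> exists l, drv l2inv (l2 p b) l.
Proof.
move=> pA; have [PA _] := P_spec A b bA.
have dl z : 0 < z < A -> drv (l2 ^~ b) z (J A z b * Jpp A z b / Jp A z b ^+ 2).
  move=> zA; have bA' : 0 < b < A by move: bA; lra.
  apply: (drv_eq _ _ _ _ (l2_drv A id (fun=> b) z _ _ zA bA' (drv_id z) (drv_cst b z))).
  by rewrite /=; field; rewrite gt_eqF// Jp_gt0.
eexists; apply: (@is_derive_inverse _ (l2 ^~ b)).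
- near=> s; apply: l2K.
  have /andP[h1 h2] : P b < s < A by near: s; exact: near_itvoo.
  by rewrite ltW.
- near=> s; apply: (drv_continuous _ _ _ (dl s _)).
  by near: s; apply: near_itvoo; lra.
- by apply: dl; lra.
have b0 := bA.
rewrite gt_eqF// divr_gt0 ?exprn_gt0 ?mulr_gt0 ?J_gt0 ?Jp_gt0//; try lra.
apply: Jpp_gt0 => //; first lra.
by rewrite leNgt K_lt0_P// -?leNgt; lra.
Unshelve. all: by end_near. Qed.

(** The argument stands for x/t + nu. Up to [L b] both profiles follow the curve K = 0; beyond it
    the third one is frozen at [b]. *)
Definition U3 xi : R := if xi <= L b then Linv xi else b.
Definition U2 xi : R := if xi <= L b then P (Linv xi) else l2inv xi.

Lemma U_left xi : 3 * A / 4 < xi <= L b ->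
  exists2 q, b <= q < A / 4 & [/\ L q = xi, U3 xi = q & U2 xi = P q].
Proof.
move=> xiA; have [q qb Lq] := L_surj A b xi bA xiA.
exists q => //; have b0 := bA.
have /andP[_ xib] := xiA; rewrite /U3 /U2 xib -Lq LK//; lra.
Qed.

Lemma U_right xi : L b <= xi < 2 * A + b ->
  exists2 p, P b <= p < A & [/\ l2 p b = xi, U3 xi = b & U2 xi = p].
Proof.
move=> xiA; have [p pA lp] := l2_surj A b xi bA xiA.
exists p => //; rewrite /U3 /U2; have [h|h] := leP xi (L b); last first.
  by rewrite -lp l2K.
(* At the junction the definitions use the left branch; it gives P b and b, and injectivity of [l2]
   identifies P b with [p]. *)
have e : xi = L b by apply/eqP; rewrite eq_le h; case/andP: xiA.
have [PA _] := P_spec A b bA.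
rewrite e LK//; split; [by rewrite lp|by []|].
by apply/esym/l2_inj => //; [lra|rewrite lp e].
Qed.

Lemma U_itv xi : 3 * A / 4 < xi < 2 * A + b -> b <= U3 xi /\ U3 xi < U2 xi < A.
Proof.
move=> /andP[h1 h2]; have b0 := bA; have [h|h] := leP xi (L b).
  have [|q qb [_ -> ->]] := U_left xi; first by rewrite h1.
  have [PA _] := P_spec A q ltac:(lra).
  split; lra.
have [|p pA [_ -> ->]] := U_right xi; first by rewrite ltW.
have [PA _] := P_spec A b bA.
split; lra.
Qed.

Lemma U_l2_l3 xi : 3 * A / 4 < xi <= L b ->
  l2 (U2 xi) (U3 xi) = xi /\ l3 (U2 xi) (U3 xi) = xi.
Proof.
move=> /U_left[q qb [Lq -> ->]]; have b0 := bA.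
have [PA KP] := P_spec A q ltac:(lra).
have e : l2 (P q) q = l3 (P q) q by apply/l2_eq_l3 => //; lra.
by rewrite -e.
Qed.

Lemma U_drv_left xi : 3 * A / 4 < xi < L b ->
  (exists l, drv U2 xi l) /\ (exists l, drv U3 xi l).
Proof.
move=> xiA; have b0 := bA.
have [|q qb [Lq _ _]] := U_left xi; first lra.
have qA : 0 < q < A / 4 by lra.
have nxi : \forall s \near xi, s <= L b.
  by near=> s; apply/ltW; near: s; apply: lt_nbhsl; lra.
split; eexists.
  apply: (@near_eq_is_derive _ _ _ (fun s => P (Linv s))).
    by near=> s; rewrite /U2 ifT//; near: s.
  apply: (drv_comp P Linv xi (dP A q)); first by rewrite -Lq LK//; exact: P_drv.
  by rewrite -Lq; exact: Linv_drv.
apply: (@near_eq_is_derive _ _ _ Linv).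
  by near=> s; rewrite /U3 ifT//; near: s.
by rewrite -Lq; exact: Linv_drv.
Unshelve. all: by end_near. Qed.

Lemma U_drv_right xi : L b < xi < 2 * A + b ->
  (exists l, drv U2 xi l) /\ drv U3 xi 0.
Proof.
move=> xiA; have [|p pA [lp _ _]] := U_right xi; first lra.
have nxi : \forall s \near xi, ~~ (s <= L b).
  by near=> s; rewrite -ltNge; near: s; apply: lt_nbhsr; lra.
split.
  have Pp : P b < p < A.
    have : P b != p.
      by apply/eqP => e; move: xiA; rewrite -lp -e -/(L b) ltxx.
    by case/andP: pA => h1 h2 h; rewrite lt_neqAle h h1.
  have [l dl] := l2inv_drv _ Pp.
  exists l; apply: (@near_eq_is_derive _ _ _ l2inv); last by rewrite -lp.
  by near=> s; rewrite /U2 ifN//; near: s.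
apply: near_eq_is_derive (drv_cst b xi).
by near=> s; rewrite /U3 ifN//; near: s.
Unshelve. all: by end_near. Qed.

(** The limit is taken in the left neighbourhoods of A/4, not merely at A/4, in order to compose
    with [P_cvg]. *)
Lemma U3_cvg_trailing : U3 xi @[xi --> (3 * A / 4)^'+] --> (A / 4)^'-.
Proof.
have b0 := bA; move=> S [/= d d0 dS].
pose q0 : R := Num.max b (A / 4 - d / 2).
have q0A : q0 < A / 4 by rewrite gt_max; move: d0 => /=; lra.
have [h1 h2] : b <= q0 /\ A / 4 - d / 2 <= q0 by split; rewrite le_max lexx ?orbT.
have Lq0 : 3 * A / 4 < L q0 by apply: L_gt => //; lra.
have Lb : L q0 <= L b.
  by move: h1; rewrite le_eqVlt => /orP[/eqP<-//|h]; apply/ltW/L_lt => //; lra.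
suff : \forall xi \near (3 * A / 4)^'+, S (U3 xi) by [].
near=> xi.
have xi1 : 3 * A / 4 < xi by near: xi; exact: nbhs_right_gt.
have xi2 : xi < L q0 by near: xi; exact: nbhs_right_lt.
have [|q qb [Lq -> _]] := U_left xi; first by rewrite xi1 ltW// (lt_le_trans xi2).
have qq : q0 < q.
  rewrite ltNge; apply/negP; rewrite le_eqVlt => /orP[/eqP e|h].
    by move: xi2; rewrite -Lq e ltxx.
  have := L_lt A q q0 ltac:(lra) h q0A; rewrite Lq; lra.
by apply: dS => /=; [rewrite ltr_norml|]; lra.
Unshelve. all: by end_near. Qed.

Lemma U_cvg_trailing :
  U2 xi @[xi --> (3 * A / 4)^'+] --> A / 4 /\ U3 xi @[xi --> (3 * A / 4)^'+] --> A / 4.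
Proof.
have b0 := bA; split; last first.
  by apply: cvg_trans U3_cvg_trailing _; exact: cvg_within.
have := cvg_comp _ _ U3_cvg_trailing (P_cvg A A0).
apply: cvg_trans; apply: near_eq_cvg; near=> xi => /=.
have xi1 : 3 * A / 4 < xi by near: xi; exact: nbhs_right_gt.
have xi2 : xi < L b.
  by near: xi; apply: nbhs_right_lt; apply: L_gt.
by rewrite /U2 /U3 ltW.
Unshelve. all: by end_near. Qed.

Lemma U_cvg_leading :
  U2 xi @[xi --> (2 * A + b)^'-] --> A /\ U3 xi @[xi --> (2 * A + b)^'-] --> b.
Proof.
have b0 := bA; have [PA _] := P_spec A b bA.
have Lb : L b < 2 * A + b by apply: l2_lt_top; lra.
split; apply/cvgrPdist_le => e e0; last first.
  near=> xi; have [|p _ [_ -> _]] := U_right xi.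
    apply/andP; split; last by near: xi; exact: nbhs_left_lt.
    by apply/ltW; near: xi; exact: nbhs_left_gt.
  by rewrite subrr normr0 ltW.
(* A barrier within e of A: its speed is below 2A + b, so ratios close to the edge correspond to
   points beyond it. *)
pose p0 : R := Num.max (P b) (A - e).
have p0A : p0 < A by rewrite gt_max; lra.
have [h1 h2] : P b <= p0 /\ A - e <= p0 by split; rewrite le_max lexx ?orbT.
have l0 : l2 p0 b < 2 * A + b by apply: l2_lt_top; lra.
near=> xi.
have xi1 : xi < 2 * A + b by near: xi; exact: nbhs_left_lt.
have xi2 : l2 p0 b < xi by near: xi; exact: nbhs_left_gt.
have xi3 : L b < xi by near: xi; exact: nbhs_left_gt.
have [|p pA [lp _ ->]] := U_right xi; first by rewrite ltW.
have pp : p0 <= p.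
  rewrite leNgt; apply/negP => h.
  have := l2_lt A p p0 b bA ltac:(lra) h p0A; rewrite lp; lra.
by rewrite ler_norml; lra.
Unshelve. all: by end_near. Qed.

End SelfSimilar.

(** * From the improper integral to the averages *)

Section Speeds.
Context {R : realType}.


Lemma seg0 (p q : R) : seg p q 0 = q.
Proof. by rewrite /seg /sin2 sin0 expr0n/= mulr0 addr0. Qed.

Lemma seg_pihalf (p q : R) : seg p q (pi / 2) = p.
Proof. by rewrite /seg /sin2 sin_pihalf expr1n mulr1 addrC subrK. Qed.

Lemma seg_increasing (p q : R) : q < p ->
  {in `[0, pi / 2] &, {homo seg p q : x y / x < y}}.
Proof.
move=> qp x y; rewrite !in_itv/= => /andP[x0 xp] /andP[y0 yp] xy.
have pi0 := @pihalf_gt0 R.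
have sx : 0 <= sin x by apply: sin_ge0_pi; lra.
have sxy : sin x < sin y by rewrite ltr_sin// in_itv/=; lra.
rewrite /seg ltrD2l ltr_pM2l ?subr_gt0// /sin2.
by rewrite ltrXn2r// nnegrE; lra.
Qed.

Lemma Iint_J (nu a u2 u3 : R) : - nu < u3 -> u3 < u2 < a ->
  Iint nu a u2 u3 = 2 * J (a + nu) (u2 + nu) (u3 + nu).
Proof.
move=> h3 h2; set A := a + nu; set p := u2 + nu; set q := u3 + nu.
have pA : 0 < p < A by rewrite /p /A; lra.
have qA : 0 < q < A by rewrite /q /A; lra.
have qp : 0 < p - q by rewrite /p /q; lra.
have cJ := continuous_savg A _ _ p q (continuous_phi A) continuous_cst1 pA qA.
rewrite /J /savg -sintZ// /Iint.
set G := fun eta : R => (eta + nu) / Num.sqrt ((eta + nu) * (a - eta) * (u2 - eta) * (eta - u3)).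
have -> : `]u3, u2[%classic = `](seg u2 u3 0), (seg u2 u3 (pi / 2))[%classic.
  by rewrite seg0 seg_pihalf.
apply: (@ge0_integration_by_substitution_oo _ _ (fun x => (u2 - u3) * (2 * sin x * cos x))).
- exact: pihalf_gt0.
- exact: is_derive_seg.
- apply: continuousZ_fun; apply: continuousM_fun; last exact: continuous_cos.
  by apply: continuousZ_fun; exact: continuous_sin.
- by apply: seg_increasing; lra.
- rewrite seg0 seg_pihalf => y; rewrite in_itv/= => yu.
  have y0 : 0 < (y + nu) * (a - y) * (u2 - y) * (y - u3) by rewrite !mulr_gt0//; lra.
  apply: cvgM.
    by apply: cvgD; [exact: cvg_id|exact: cvg_cst].
  apply: cvgV; first by rewrite gt_eqF// sqrtr_gt0.
  apply: (@continuous_comp _ _ _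
    (fun eta => (eta + nu) * (a - eta) * (u2 - eta) * (eta - u3)) Num.sqrt).
    by eapply drv_continuous; drv_lambda fail.
  exact: sqrt_continuous.
- rewrite seg0 seg_pihalf => y yu; rewrite divr_ge0 ?sqrtr_ge0//; lra.
- exact: continuousZ_fun.
- move=> x xp; rewrite mulr1 /G.
  have segE : seg u2 u3 x + nu = seg p q x by rewrite /seg /p /q; ring.
  have sA : 0 < seg p q x < A by exact: seg_itvoo.
  have s0 : 0 < sin x by exact: sin_gt0_pihalf.
  have c0 : 0 < cos x by apply: cos_gt0_pihalf; lra.
  have f0 := phi_gt0 A _ sA; have f2 := phi_sqr A _ sA.
  (* Writing eta as phi(eta)^2 (A - eta) makes the radicand a perfect square, and the sine and
     cosine cancel against the Jacobian. *)
  have yA : seg p q x = phi A (seg p q x) ^+ 2 * (A - seg p q x).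
    by rewrite f2 divfK// gt_eqF//; lra.
  have -> : (seg u2 u3 x + nu) * (a - seg u2 u3 x) * (u2 - seg u2 u3 x) * (seg u2 u3 x - u3)
     = (phi A (seg p q x) * (A - seg p q x) * ((p - q) * (sin x * cos x))) ^+ 2.
    have -> : a - seg u2 u3 x = A - seg p q x by rewrite -segE /A; ring.
    have -> : (u2 - seg u2 u3 x) = (p - q) * cos x ^+ 2.
      by rewrite cos2sin2 /seg /p /q /sin2; ring.
    have -> : (seg u2 u3 x - u3) = (p - q) * sin x ^+ 2 by rewrite /seg /p /q /sin2; ring.
    by rewrite segE [X in X * _ * _ * _]yA; ring.
  have D0 : 0 < phi A (seg p q x) * (A - seg p q x) * ((p - q) * (sin x * cos x)).
    by rewrite !mulr_gt0//; lra.
  rewrite sqrtr_sqr gtr0_norm// segE [X in _ = X / _ * _]yA.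
  have -> : u2 - u3 = p - q by rewrite /p /q; ring.
  by field; rewrite !gt_eqF//; lra.
- move=> x _; rewrite mulr1 mulr_ge0// ltW// phi_gt0//; exact: seg_itvoo.
Qed.

(** The identity with [J] holds only under the ordering of the arguments, but that ordering persists
    near u2, which is enough to transfer the derivative. *)
Lemma dI2_Jp (nu a u2 u3 : R) : - nu < u3 -> u3 < u2 < a ->
  dI2 nu a u2 u3 = 2 * Jp (a + nu) (u2 + nu) (u3 + nu).
Proof.
move=> h3 h2; rewrite /dI2 derive1E.
have hJ : drv (fun s => 2 * J (a + nu) (s + nu) (u3 + nu)) u2
    (2 * Jp (a + nu) (u2 + nu) (u3 + nu)).
  have gJ : grad (J (a + nu)) (u2 + nu) (u3 + nu)
      (Jp (a + nu) (u2 + nu) (u3 + nu)) (Jq (a + nu) (u2 + nu) (u3 + nu)).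
    by apply: J_grad; lra.
  eapply drv_eq.
    eapply drvM; first exact: drv_cst.
    eapply (grad_derive _ _ _ (fun s => s + nu) (fun=> u3 + nu)); first exact: gJ.
      by apply: drvD; [exact: drv_id|exact: drv_cst].
    exact: drv_cst.
  by cbv beta; ring.
case: hJ => _ <-; apply: near_eq_derive.
near=> s; rewrite Iint_J//.
apply/andP; split; near: s; [apply: lt_nbhsr|apply: lt_nbhsl]; lra.
Unshelve. all: by end_near. Qed.

Lemma dI3_Jq (nu a u2 u3 : R) : - nu < u3 -> u3 < u2 < a ->
  dI3 nu a u2 u3 = 2 * Jq (a + nu) (u2 + nu) (u3 + nu).
Proof.
move=> h3 h2; rewrite /dI3 derive1E.
have hJ : drv (fun s => 2 * J (a + nu) (u2 + nu) (s + nu)) u3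
    (2 * Jq (a + nu) (u2 + nu) (u3 + nu)).
  have gJ : grad (J (a + nu)) (u2 + nu) (u3 + nu)
      (Jp (a + nu) (u2 + nu) (u3 + nu)) (Jq (a + nu) (u2 + nu) (u3 + nu)).
    by apply: J_grad; lra.
  eapply drv_eq.
    eapply drvM; first exact: drv_cst.
    eapply (grad_derive _ _ _ (fun=> u2 + nu) (fun s => s + nu)); first exact: gJ.
      exact: drv_cst.
    by apply: drvD; [exact: drv_id|exact: drv_cst].
  by cbv beta; ring.
case: hJ => _ <-; apply: near_eq_derive.
near=> s; rewrite Iint_J//.
  by near: s; apply: lt_nbhsr; lra.
apply/andP; split; last lra.
by near: s; apply: lt_nbhsl; lra.
Unshelve. all: by end_near. Qed.

Lemma lam2_l2 (nu a u2 u3 : R) : - nu < u3 -> u3 < u2 < a ->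
  lam2 nu a u2 u3 = l2 (a + nu) (u2 + nu) (u3 + nu) - nu.
Proof.
move=> h3 h2; rewrite /lam2 Iint_J// dI2_Jp// /l2.
have : Jp (a + nu) (u2 + nu) (u3 + nu) != 0 by rewrite gt_eqF// Jp_gt0//; lra.
by move=> j0; field.
Qed.

Lemma lam3_l3 (nu a u2 u3 : R) : - nu < u3 -> u3 < u2 < a ->
  lam3 nu a u2 u3 = l3 (a + nu) (u2 + nu) (u3 + nu) - nu.
Proof.
move=> h3 h2; rewrite /lam3 Iint_J// dI3_Jq// /l3.
have : Jq (a + nu) (u2 + nu) (u3 + nu) != 0 by rewrite gt_eqF// Jq_gt0//; lra.
by move=> j0; field.
Qed.

End Speeds.

(** * Self-similar and locally constant solutions; one-sided limits at the edges *)

Section Transport.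
Context {R : realType}.

(** The equation reduces to V'(x/t) (c - x/t) / t = 0. The case V' = 0 serves u3 = b, where the
    speed lambda_3 need not equal x/t. *)
Lemma transport_selfsimilar (V : R -> R) (c : R -> R -> R) (x t l : R) :
  0 < t -> drv V (x / t) l -> l = 0 \/ c x t = x / t ->
  transport_at (fun x t => V (x / t)) c x t.
Proof.
move=> t0 dV h; have t1 : t != 0 by rewrite gt_eqF.
have dx : drv (fun s => V (s / t)) x (l * t^-1).
  apply: (drv_comp V (fun s => s / t)); first exact: dV.
  eapply drv_eq; first by eapply drvM; [exact: drv_id|exact: drv_cst].
  by rewrite /=; ring.
have dt : drv (fun s => V (x / s)) t (l * (- x / t ^+ 2)).
  apply: (drv_comp V (fun s => x / s)); first exact: dV.
  eapply drv_eq.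
    eapply drvM; first exact: drv_cst.
    by eapply drvV; [exact: t1|exact: drv_id].
  by rewrite /=; field.
case: dx => ex vx; case: dt => et vt; split; [exact: ex|split; [exact: et|]].
rewrite !derive1E vx vt; case: h => [->|->]; first by rewrite !mul0r mulr0 addr0.
by field.
Qed.

(** The speed is arbitrary: this settles u1 = a without any knowledge of lambda_1. *)
Lemma transport_locally_cst (u c : R -> R -> R) (x t k : R) :
  (\forall s \near x, u s t = k) -> (\forall s \near t, u x s = k) ->
  transport_at u c x t.
Proof.
move=> hx ht.
have dx : drv (fun s => u s t) x 0.
  apply: near_eq_is_derive (drv_cst k x).
  by apply: filterS hx => s ->.
have dt : drv (fun s => u x s) t 0.
  apply: near_eq_is_derive (drv_cst k t).
  by apply: filterS ht => s ->.
case: dx => ex vx; case: dt => et vt; split; [exact: ex|split; [exact: et|]].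
by rewrite !derive1E vx vt mulr0 addr0.
Qed.

(** The target is the right neighbourhood, since the profiles have only a one-sided limit at the
    trailing edge. *)
Lemma affine_at_right (t k m : R) : 0 < t ->
  x / t + m @[x --> (t * k)^'+] --> (k + m)^'+.
Proof.
move=> t0 S [d /= d0 dS]; exists (d * t); first by rewrite /= mulr_gt0.
move=> x /= xd xk; apply: dS => /=; last by rewrite ltrD2r ltr_pdivlMr// mulrC.
have -> : k + m - (x / t + m) = (t * k - x) / t by field; rewrite gt_eqF.
by rewrite normrM normfV (gtr0_norm t0) ltr_pdivrMr.
Qed.

Lemma affine_at_left (t k m : R) : 0 < t ->
  x / t + m @[x --> (t * k)^'-] --> (k + m)^'-.
Proof.
move=> t0 S [d /= d0 dS]; exists (d * t); first by rewrite /= mulr_gt0.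
move=> x /= xd xk; apply: dS => /=; last by rewrite ltrD2r ltr_pdivrMr// mulrC.
have -> : k + m - (x / t + m) = (t * k - x) / t by field; rewrite gt_eqF.
by rewrite normrM normfV (gtr0_norm t0) ltr_pdivrMr.
Qed.

Lemma burgers_outerE (nu a b x t : R) : 0 < t ->
  burgers_outer nu a b x t = if x / t <= (3 * a - nu) / 4 then a else b.
Proof. by move=> t0; rewrite /burgers_outer gt_eqF. Qed.

Lemma near_ratio (Q : R -> bool) (x t : R) : 0 < t ->
  (\forall xi \near x / t, Q xi) ->
  (\forall s \near x, Q (s / t)) /\ (\forall s \near t, 0 < s /\ Q (x / s)).
Proof.
move=> t0 hQ; have t1 : t != 0 by rewrite gt_eqF.
split.
  have : s / t @[s --> x] --> x / t by apply: cvgM; [exact: cvg_id|exact: cvg_cst].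
  by move=> /(_ _ hQ).
have : x / s @[s --> t] --> x / t.
  by apply: cvgM; [exact: cvg_cst|apply: cvgV => //; exact: cvg_id].
move=> /(_ _ hQ) h; near=> s; split; near: s => //.
exact: lt_nbhsr.
Unshelve. all: by end_near. Qed.

(** For t > 0 the function jumps only at the trailing ratio, its value being b in the Whitham zone
    as well, so one exclusion covers both outer regions. *)
Lemma burgers_outer_transport (nu a b x t : R) (c : R -> R -> R) : 0 < t ->
  x / t != (3 * a - nu) / 4 -> transport_at (burgers_outer nu a b) c x t.
Proof.
move=> t0; rewrite neq_lt => /orP[h|h].
  have [] := near_ratio (fun xi => xi < (3 * a - nu) / 4) x t t0 (lt_nbhsl h).
  move=> hx ht; apply: (@transport_locally_cst _ _ _ _ a).
    by apply: filterS hx => s sh; rewrite burgers_outerE// ltW.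
  by apply: filterS ht => s [s0 sh]; rewrite burgers_outerE// ltW.
have [] := near_ratio (fun xi => (3 * a - nu) / 4 < xi) x t t0 (lt_nbhsr h).
move=> hx ht; apply: (@transport_locally_cst _ _ _ _ b).
  by apply: filterS hx => s sh; rewrite burgers_outerE// leNgt sh.
by apply: filterS ht => s [s0 sh]; rewrite burgers_outerE// leNgt sh.
Qed.

End Transport.

Theorem theorem4p1 (R : realType) (nu a b : R) :
  0 < b + nu < (a + nu) / 4 ->
  exists us : R,
    (* (1) unique solution u* of lambda_2(a,u,b) = lambda_3(a,u,b) in ]b,a[ *)
    [/\ b < us < a, lam2 nu a us b = lam3 nu a us b &
        forall v : R, b < v < a -> lam2 nu a v b = lam3 nu a v b -> v = us] /\
    let alpha := lam2 nu a us b in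
    (* (2) the Whitham zone *)
    exists u2 u3 : R -> R -> R,
      let u1 := fun (_ _ : R) => a in
      let inW := fun x t : R => 0 < t /\ (3 * a - nu) / 4 < x / t < 2 * a + b + 2 * nu in
      [/\ (forall x t, inW x t -> b <= u3 x t /\ u3 x t < u2 x t < a),
          (forall x t, inW x t -> x / t <= alpha ->
             x = lam2 nu a (u2 x t) (u3 x t) * t /\
             x = lam3 nu a (u2 x t) (u3 x t) * t),
          (forall x t, inW x t -> alpha <= x / t ->
             x = lam2 nu a (u2 x t) b * t /\ u3 x t = b),
          (* Whitham equations (classically, off the weak-discontinuity line x/t = alpha) *)
          (forall x t, inW x t -> x / t != alpha ->
             [/\ transport_at u1 (fun x t => lam1 nu (u1 x t) (u2 x t) (u3 x t)) x t,
                 transport_at u2 (fun x t => lam2 nu (u1 x t) (u2 x t) (u3 x t)) x t &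
                 transport_at u3 (fun x t => lam3 nu (u1 x t) (u2 x t) (u3 x t)) x t]) &
          (* (3) Burgers region and matching at the edges *)
          [/\ (forall x, x < 0 -> burgers_outer nu a b x 0 = a) /\
                (forall x, 0 < x -> burgers_outer nu a b x 0 = b),
              (forall x t, 0 < t -> x / t <= (3 * a - nu) / 4 -> burgers_outer nu a b x t = a) /\
                (forall x t, 0 < t -> 2 * a + b + 2 * nu <= x / t -> burgers_outer nu a b x t = b),
              (forall x t, 0 < t ->
                 (x / t < (3 * a - nu) / 4 \/ 2 * a + b + 2 * nu < x / t) ->
                 transport_at (burgers_outer nu a b)
                   (fun x t => 3 * burgers_outer nu a b x t + 2 * nu) x t),
              (* trailing edge: u1 = u and u2 = u3 *)
              (forall t, 0 < t ->
                 u1 (t * ((3 * a - nu) / 4)) t = burgers_outer nu a b (t * ((3 * a - nu) / 4)) t /\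
                 exists c : R,
                   u2 x t @[x --> (t * ((3 * a - nu) / 4))^'+] --> c /\
                   u3 x t @[x --> (t * ((3 * a - nu) / 4))^'+] --> c) &
              (* leading edge: u1 = u2 and u3 = u *)
              (forall t, 0 < t ->
                 u2 x t @[x --> (t * (2 * a + b + 2 * nu))^'-] --> u1 (t * (2 * a + b + 2 * nu)) t /\
                 u3 x t @[x --> (t * (2 * a + b + 2 * nu))^'-] -->
                   burgers_outer nu a b (t * (2 * a + b + 2 * nu)) t)]].
Proof.
set A := a + nu; set b' := b + nu => bA.
have [PA KP] := P_spec A b' bA.
have A0 : 0 < A by lra.
have lam2E (v w : R) : - nu < w -> w < v < a -> lam2 nu a v w = l2 A (v + nu) (w + nu) - nu.
  exact: lam2_l2.
have lam3E (v w : R) : - nu < w -> w < v < a -> lam3 nu a v w = l3 A (v + nu) (w + nu) - nu.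
  exact: lam3_l3.
have nb : - nu < b by move: bA; rewrite /b'; lra.
have aE : a = A - nu by rewrite /A; lra.
have bE : b = b' - nu by rewrite /b'; lra.
exists (P A b' - nu); split.
  have usb : b < P A b' - nu < a by lra.
  split; first exact: usb.
    rewrite (lam2E _ _ nb usb) (lam3E _ _ nb usb) subrK -/b'; congr (_ - _).
    by apply/l2_eq_l3; [lra|lra|exact: KP].
  move=> v vb; rewrite (lam2E _ _ nb vb) (lam3E _ _ nb vb) -/b' => /addIr /l2_eq_l3 h.
  rewrite -(P_uniq A (v + nu) b' bA); [lra|lra|].
  by apply: h; lra.
have alphaE : lam2 nu a (P A b' - nu) b = L A b' - nu.
  by rewrite (lam2E _ _ nb) ?subrK; [|lra].
cbv zeta; rewrite alphaE.
exists (fun x t => U2 A b' (x / t + nu) - nu), (fun x t => U3 A b' (x / t + nu) - nu).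
(* The shift by nu sends the edges (3a - nu)/4 and 2a + b + 2nu to 3A/4 and 2A + b'. *)
have inWE (x t : R) : 0 < t /\ (3 * a - nu) / 4 < x / t < 2 * a + b + 2 * nu ->
    0 < t /\ 3 * A / 4 < x / t + nu < 2 * A + b'.
  by rewrite /A /b' => -[-> h]; split=> //; lra.
have xE (x t y : R) : 0 < t -> y = x / t -> x = y * t.
  by move=> t0 ->; rewrite divfK// gt_eqF.
split.
- move=> x t /inWE[t0 xiA]; have := U_itv A b' bA _ xiA; lra.
- move=> x t /inWE[t0 xiA] xia.
  have [h1 h2] := U_itv A b' bA _ xiA.
  have [|e2 e3] := U_l2_l3 A b' bA (x / t + nu); first lra.
  split; apply: (xE _ _ _ t0).
    by rewrite lam2E ?subrK ?e2; lra.
  by rewrite lam3E ?subrK ?e3; lra.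
- move=> x t /inWE[t0 xiA] xia.
  have [|p pA [lp e3 e2]] := U_right A b' bA (x / t + nu); first lra.
  split; last by rewrite e3; lra.
  by apply: (xE _ _ _ t0); rewrite e2 lam2E ?subrK -/b' ?lp; lra.
- move=> x t /inWE[t0 xiA] xia.
  have [h1 h2] := U_itv A b' bA _ xiA.
  have dshift U l : drv U (x / t + nu) l -> drv (fun xi => U (xi + nu) - nu) (x / t) l.
    move=> dU; eapply drv_eq.
      eapply drvD; last exact: drv_cst.
      eapply (drv_comp U (fun xi => xi + nu)); first exact: dU.
      by eapply drvD; [exact: drv_id|exact: drv_cst].
    by rewrite /=; ring.
  split.
  + by apply: (transport_locally_cst _ _ _ _ a); exact: filterE.
  + case: (ltgtP (x / t) (L A b' - nu)) xia => // h _.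
      have [|[l dl] _] := U_drv_left A b' bA (x / t + nu); first lra.
      apply: (transport_selfsimilar (fun xi => U2 A b' (xi + nu) - nu) _ _ _ l t0).
        exact: dshift.
      right; have [|e2 _] := U_l2_l3 A b' bA (x / t + nu); first lra.
      by rewrite lam2E ?subrK ?e2; lra.
    have [|[l dl] _] := U_drv_right A b' bA (x / t + nu); first lra.
    apply: (transport_selfsimilar (fun xi => U2 A b' (xi + nu) - nu) _ _ _ l t0).
      exact: dshift.
    right; have [|p pA [lp e3 e2]] := U_right A b' bA (x / t + nu); first lra.
    by rewrite e3 e2 lam2E ?subrK ?lp; lra.
  + case: (ltgtP (x / t) (L A b' - nu)) xia => // h _.
      have [|_ [l dl]] := U_drv_left A b' bA (x / t + nu); first lra.
      apply: (transport_selfsimilar (fun xi => U3 A b' (xi + nu) - nu) _ _ _ l t0).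
        exact: dshift.
      right; have [|_ e3] := U_l2_l3 A b' bA (x / t + nu); first lra.
      by rewrite lam3E ?subrK ?e3; lra.
    have [|_ dl] := U_drv_right A b' bA (x / t + nu); first lra.
    apply: (transport_selfsimilar (fun xi => U3 A b' (xi + nu) - nu) _ _ _ 0 t0).
      exact: dshift.
    (* Beyond the junction u3 is constant, so the equation holds whatever the value of lambda_3. *)
    by left.
- have klt : (3 * a - nu) / 4 < 2 * a + b + 2 * nu by lra.
  split.
  + by split=> x x0; rewrite /burgers_outer eqxx ?x0// ltNge (ltW x0).
  + split=> x t t0 h; rewrite burgers_outerE// ?h//.
    by rewrite leNgt (lt_le_trans klt h).
  + move=> x t t0 h; apply: burgers_outer_transport => //.
    by rewrite neq_lt; case: h => [->//|h]; rewrite (lt_trans klt h) orbT.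
  + move=> t t0; split; first by rewrite burgers_outerE// mulrAC divff ?gt_eqF// mul1r lexx.
    have kE : (3 * a - nu) / 4 + nu = 3 * A / 4 by rewrite /A; lra.
    have := affine_at_right t ((3 * a - nu) / 4) nu t0; rewrite kE => h.
    have [c2 c3] := U_cvg_trailing A b' bA.
    exists (A / 4 - nu); split; apply: cvgB; try exact: cvg_cst.
      exact: cvg_comp h c2.
    exact: cvg_comp h c3.
  + move=> t t0.
    have kE : 2 * a + b + 2 * nu + nu = 2 * A + b' by rewrite /A /b'; lra.
    have := affine_at_left t (2 * a + b + 2 * nu) nu t0; rewrite kE => h.
    have [c2 c3] := U_cvg_leading A b' bA.
    rewrite burgers_outerE// mulrAC divff ?gt_eqF// mul1r leNgt klt /=.
    rewrite [in X in _ --> X /\ _]aE [in X in _ /\ (_ --> X)]bE.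
    split; apply: cvgB; try exact: cvg_cst.
      exact: cvg_comp h c2.
    exact: cvg_comp h c3.
Qed.
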